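(* Let $\alpha \approx 2.956$ be Otter's tree constant, i.e. the constant $\alpha>0$ such that the number of pairwise non-isomorphic (unlabelled) trees on $n$ vertices is $(1+o(1))\,C n^{-5/2}\alpha^n$ for an absolute constant $C>0$. For every $0<\varepsilon<\alpha$, there exist constants $d_0=d_0(\varepsilon)$ and $C=C(\varepsilon)$ such that the following holds (for all sufficiently large $n$): if $G$ is an $(n,d,\lambda)$-graph with $d\ge d_0$ and $d/\lambda\ge C$, then the number of distinct unlabelled spanning trees of $G$ is at least $(\alpha-\varepsilon)^n$.
   Context: An $(n,d,\lambda)$-graph is a $d$-regular graph on $n$ vertices whose adjacency matrix eigenvalues $d=\lambda_1\ge\lambda_2\ge\cdots\ge\lambda_n$ satisfy $\max\{\lambda_2,|\lambda_n|\}\le\lambda$. The number of distinct unlabelled spanning trees of $G$ is the number of isomorphism classes of spanning trees of $G$, where two trees $T,T'$ are isomorphic if there is a bijection $\sigma:V(T)\to V(T')$ with $\{u,v\}\in E(T)$ iff $\{\sigma(u),\sigma(v)\}\in E(T')$. Throughout the paper $n$ is assumed sufficiently large. *)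

(* Defs.v *)
From HB Require Import structures.
From mathcomp Require Import all_boot all_order all_algebra.
From mathcomp Require Import fingroup perm.
From mathcomp Require Import boolp classical_sets reals topology normedtype sequences.
Set Implicit Arguments. Unset Strict Implicit. Unset Printing Implicit Defensive.
Import Order.TTheory GRing.Theory Num.Theory numFieldNormedType.Exports.
Local Open Scope ring_scope.

(* A graph on a finite vertex type V is given by its edge set: a set of
   2-element subsets of V. *)
Section Graphs.
Variable V : finType.

Definition is_simple_edges (E : {set {set V}}) : bool :=
  [forall e in E, #|e| == 2]%N.

Definition adj (E : {set {set V}}) : rel V := fun x y => [set x; y] \in E.

Definition connectedE (E : {set {set V}}) : Prop :=
  forall x y : V, connect (adj E) x y.

Definition acyclicE (E : {set {set V}}) : Prop :=
  forall s : seq V, uniq s -> (2 < size s)%N -> ~~ path.cycle (adj E) s.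

Definition is_tree (E : {set {set V}}) : Prop :=
  is_simple_edges E /\ connectedE E /\ acyclicE E.

Definition tree_iso (T T' : {set {set V}}) : Prop :=
  exists s : {perm V}, forall u v : V,
    ([set u; v] \in T) = ([set s u; s v] \in T').

Definition edges_of (e : rel V) : {set {set V}} :=
  [set [set x; y] | x in V, y in V & e x y].

Definition is_spanning_tree (e : rel V) (T : {set {set V}}) : Prop :=
  T \subset edges_of e /\ is_tree T.

Definition iso_class (P : {set {set V}} -> Prop) (T : {set {set V}})
  : {set {set {set V}}} :=
  [set T' : {set {set V}} | `[< P T' /\ tree_iso T T' >]].
End Graphs.

Definition num_classes (V : finType) (P : {set {set V}} -> Prop) : nat :=
  #|[set iso_class P T | T in [set T : {set {set V}} | `[< P T >]]]|.

Definition num_unlabelled_spanning_trees (V : finType) (e : rel V) : nat :=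
  num_classes (@is_spanning_tree V e).

Definition num_unlabelled_trees (n : nat) : nat :=
  num_classes (@is_tree 'I_n).

Definition simple_graph (n : nat) (e : rel 'I_n) : Prop :=
  symmetric e /\ irreflexive e.

Definition regular (n d : nat) (e : rel 'I_n) : Prop :=
  forall x : 'I_n, #|[set y | e x y]| = d.

Definition adj_matrix (R : nzRingType) (n : nat) (e : rel 'I_n) : 'M[R]_n :=
  \matrix_(i, j) (e i j)%:R.

(* (n,d,lambda)-graph: d-regular simple graph on n vertices whose adjacency
   eigenvalues (with multiplicity, listed in non-increasing order as the roots
   of the characteristic polynomial) d = l_1 >= ... >= l_n satisfy
   max(l_2, |l_n|) <= lambda. *)
Definition ndl_graph (R : realType) (n d : nat) (lam : R) (e : rel 'I_n) : Prop :=
  simple_graph e /\ regular d e /\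
  exists s : seq R,
    [/\ size s = n /\
        sorted (fun x y => y <= x) s,
        char_poly (adj_matrix R e) = \prod_(x <- s) ('X - x%:P),
        s`_0 = d%:R,
        s`_1 <= lam &
        `|s`_(n.-1)| <= lam].

Local Open Scope classical_set_scope.
Definition otter_constant (R : realType) (alpha : R) : Prop :=
  0 < alpha /\
  exists C : R, 0 < C /\
    (fun n : nat => (num_unlabelled_trees n)%:R
        / (C * (n%:R ^+ 2 * Num.sqrt n%:R)^-1 * alpha ^+ n)) @ \oo --> (1 : R).

(* Main.v *)
(* Fix K and join any sequence of M unlabelled trees on K vertices into a
   "string" by linking their roots (the vertices 0) along a path, the spine.
   For K large, Otter's asymptotics gives at least (alpha - eps')^K choices per
   tree.  In an expander, a depth-first search along the spine embeds each such
   string on all but a small fraction of the vertices, and the image extends to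
   a spanning tree S.  Since S is acyclic it induces exactly the string on the
   covered vertices, so the sequence can be read off from the isomorphism class
   of S together with the uncovered set, the set of roots and the first root:
   only (1 + eps'')^n possibilities.  Hence the number of classes is at least
   (number of trees on K vertices)^M / (1 + eps'')^n.  The only property of
   (n,d,lambda)-graphs used is |e(X,X) - d|X|^2/n| <= lambda |X|. *)
Require Import Defs.
From HB Require Import structures.
From mathcomp Require Import all_boot all_order all_algebra.
From mathcomp Require Import fingroup perm spectral sesquilinear complex.
From mathcomp Require Import boolp reals topology normedtype sequences.
From mathcomp Require Import zify ring lra.
Set Implicit Arguments. Unset Strict Implicit. Unset Printing Implicit Defensive.
Import Order.TTheory GRing.Theory Num.Theory.
Local Open Scope ring_scope.

(** * Growing trees leaf by leaf *)

Lemma adj_sym (V : finType) (E : {set {set V}}) : symmetric (adj E).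
Proof. by move=> x y; rewrite /adj setUC. Qed.

Lemma sub_adj_connect (V : finType) (E F : {set {set V}}) x y :
  E \subset F -> connect (adj E) x y -> connect (adj F) x y.
Proof.
move=> /subsetP sEF; apply: connect_sub => u v uv.
by apply: connect1; apply: sEF.
Qed.

(** A path in [F] with at least two edges would close up with the edge from [x] to [y] to a cycle of
    [S]. Hence a connected subgraph of an acyclic graph is induced on its vertices. *)
Lemma acyclic_sub_connect (V : finType) (S F : {set {set V}}) x y :
  acyclicE S -> F \subset S -> connect (adj F) x y -> x != y ->
  [set x; y] \in S -> [set x; y] \in F.
Proof.
move=> acS sFS /connectP[p0 pth0 ylast] xy Sxy.
case/shortenP: pth0 ylast => p pth uniqp _ ylast.
case: p pth uniqp ylast => [|z [|w p]].
- by move=> _ _ e; rewrite e eqxx in xy.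
- by move=> /= /andP[xz _] _ ->.
move=> pth uniqp ylast.
have /negP[] := acS _ uniqp isT.
rewrite /path.cycle rcons_path -ylast adj_sym /adj Sxy andbT.
apply: sub_path pth => u v; exact: (subsetP sFS).
Qed.

Section Grown.
Variable V : finType.
Implicit Types (X : {set V}) (E : {set {set V}}).

(** Trees presented by an order in which leaves are added, so that greedy embedding, gluing and
    extension all become inductions on this order. *)
Inductive grown (r : V) : {set V} -> {set {set V}} -> Prop :=
| grown_start : grown r [set r] set0
| grown_leaf X E x y : grown r X E -> x \in X -> y \notin X ->
    grown r (y |: X) ([set x; y] |: E).

Variable r : V.

Lemma grown_root X E : grown r X E -> r \in X.
Proof. by elim=> [|{}X {}E x y _ rX _ _]; rewrite !inE ?eqxx // rX orbT. Qed.

Lemma grown_edge X E x y : grown r X E -> [set x; y] \in E -> (x \in X) && (y \in X).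
Proof.
move=> g exy; suff : [set x; y] \subset X by rewrite subUset !sub1set.
elim: g exy => [|{}X {}E u v _ IH uX vX]; first by rewrite inE.
rewrite in_setU1 => /predU1P[->|/IH sX]; last exact: subset_trans sX (subsetUr _ _).
by rewrite subUset !sub1set setU11 setU1r.
Qed.

Lemma grown_simple X E : grown r X E -> is_simple_edges E.
Proof.
move=> g; apply/forall_inP; elim: g => [e|{}X {}E u v _ IH uX vX e]; first by rewrite inE.
rewrite !inE => /predU1P[->|/IH //].
by rewrite cards2; case: (eqVneq u v) uX vX => // -> ->.
Qed.

Lemma grown_connect_root X E x : grown r X E -> x \in X -> connect (adj E) r x.
Proof.
move=> g; elim: g x => [x /set1P -> //|{}X {}E u v _ IH uX vX x].
have sE : E \subset [set u; v] |: E by exact: subsetUr.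
rewrite !inE => /predU1P[->|/IH /(sub_adj_connect sE) //].
apply: connect_trans (sub_adj_connect sE (IH _ uX)) _.
by apply: connect1; rewrite /adj setU11.
Qed.

Lemma grown_connect X E x y : grown r X E -> x \in X -> y \in X -> connect (adj E) x y.
Proof.
move=> g xX yX; apply: (connect_trans (y := r)); last exact: grown_connect_root g yX.
by rewrite (sym_connect_sym (adj_sym E)); exact: grown_connect_root g xX.
Qed.

Lemma grown_acyclic X E : grown r X E -> acyclicE E.
Proof.
elim=> [|{}X {}E u v g IH uX vX] s us ss.
  by case: s us ss => [|a [|b s]] //= _ _; rewrite /adj inE.
apply/negP => cyc.
have uv : u != v by apply: contraNneq vX => <-.
(* A cycle through the new leaf v would visit its only neighbour u twice. *)
have vE z : adj ([set u; v] |: E) v z -> z = u.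
  rewrite /adj !inE => /predU1P[e|/(grown_edge g)]; last by rewrite (negPf vX).
  have := set22 v z; rewrite e => /set2P[//|zv].
  by have := set21 u v; rewrite -e zv => /set2P[] uv'; rewrite uv' eqxx in uv.
have [vs|vs] := boolP (v \in s).
  have [i t et] := rot_to vs.
  have : path.cycle (adj ([set u; v] |: E)) (v :: t) by rewrite -et rot_cycle.
  have : uniq (v :: t) by rewrite -et rot_uniq.
  have : (2 < size (v :: t))%N by rewrite -et size_rot.
  case/lastP: t {et} => [//|t z]; case: t => [//|w t] _ /= /andP[_ /andP[]].
  rewrite mem_rcons inE negb_or rcons_path last_rcons => /andP[wz _] _.
  case/andP => /vE ewu /andP[_]; rewrite adj_sym => /vE ezu.
  by rewrite ewu ezu eqxx in wz.
(* A cycle avoiding [v] cannot use the new edge, so it already lies in [E]. *)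
have /negP[] := IH _ us ss.
have sub t a : path (adj ([set u; v] |: E)) a t -> v \notin a :: t -> path (adj E) a t.
  elim: t a => [//|b t IHt] a /= /andP[ab pth].
  rewrite !inE !negb_or => /and3P[va vb vt]; rewrite IHt ?inE ?negb_or ?vb // andbT.
  move: ab; rewrite /adj !inE => /predU1P[e|//].
  by have := set22 u v; rewrite -e => /set2P[] e'; [rewrite e' eqxx in va|rewrite e' eqxx in vb].
case: s {us ss} cyc vs => [//|a s] /= pth; rewrite inE negb_or => /andP[va vs].
by apply: sub pth _; rewrite inE mem_rcons inE !negb_or va.
Qed.

Lemma grown_tree E : grown r setT E -> is_tree E.
Proof.
move=> g; split; [exact: grown_simple g|split; [|exact: grown_acyclic g]].
by move=> x y; apply: (grown_connect g); rewrite inE.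
Qed.

(** As long as a vertex is missing, an edge of [G] leaving the current vertex set supplies a new
    leaf; the induction is on the number of missing vertices. *)
Lemma grown_extend (G : {set {set V}}) X E :
  (forall A : {set V}, r \in A -> A != setT ->
     exists x y, [/\ x \in A, y \notin A & [set x; y] \in G]) ->
  grown r X E -> E \subset G ->
  exists E', [/\ grown r setT E', E \subset E' & E' \subset G].
Proof.
move=> cut; move: {2}#|~: X| (leqnn #|~: X|) => c.
elim: c X E => [|c IH] X E cX g sEG.
  exists E; split=> //; suff <- : X = setT by [].
  by apply/eqP; rewrite -subTset -setCS setCT subset0 -cards_eq0 -leqn0.
have [eX|nX] := eqVneq X setT; first by exists E; split=> //; rewrite -eX.
have [x [y [xX yX Gxy]]] := cut X (grown_root g) nX.
have [||E' [g' s1 s2]] := IH (y |: X) ([set x; y] |: E) _ (grown_leaf g xX yX).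
- have : (#|~: (y |: X)| < #|~: X|)%N.
    apply: proper_card; rewrite properE setCS subsetUr /=.
    by apply/subsetPn; exists y; rewrite !inE ?eqxx.
  by move=> h; rewrite -ltnS (leq_trans h).
- by rewrite subUset sub1set Gxy.
by exists E'; split=> //; apply: subset_trans s1; exact: subsetUr.
Qed.

End Grown.

Lemma connect_cut (V : finType) (e : rel V) (A : {set V}) x y :
  connect e x y -> x \in A -> y \notin A ->
  exists u v, [/\ u \in A, v \notin A & e u v].
Proof.
move=> /connectP[p pth ->]; elim: p x pth => [x _ /= -> //|z p IH x /= /andP[xz pth] xA yA].
have [zA|zA] := boolP (z \in A); first exact: IH pth zA yA.
by exists x, z.
Qed.

(** Growing from [r] inside [T] reaches every vertex because [T] is connected, and acyclicity of [T]
    leaves no edge outside the grown tree. *)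
Lemma tree_grown (V : finType) (T : {set {set V}}) r : is_tree T -> grown r setT T.
Proof.
move=> [simT [conT acT]].
have [A rA nA|E [g _ sET]] := grown_extend _ (grown_start r) (sub0set T).
  have /subsetPn[y _ yA] : ~~ (setT \subset A) by rewrite subTset.
  exact: connect_cut (conT r y) rA yA.
suff -> : T = E by [].
apply/eqP; rewrite eqEsubset sET andbT; apply/subsetP => e eT.
have /cards2P[x [y [xy ee]]] := forall_inP simT _ eT; subst e; apply: acyclic_sub_connect acT sET _ xy eT.
by apply: grown_connect g _ _; rewrite inE.
Qed.

Definition map_edges (Z V : finType) (f : Z -> V) (D : {set {set Z}}) : {set {set V}} :=
  (fun e : {set Z} => f @: e) @: D.

Lemma grown_map (V Z : finType) (z : Z) Y D (f : Z -> V) :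
  injective f -> grown z Y D -> grown (f z) (f @: Y) (map_edges f D).
Proof.
move=> injf; elim=> [|{}Y {}D u v _ IH uY vY].
  rewrite /map_edges imset0 imset_set1; exact: grown_start.
rewrite /map_edges !imsetU1 imset_set1; apply: grown_leaf IH _ _.
  by rewrite imset_f.
by rewrite mem_imset.
Qed.

(** The edge from [x] to [f z] adds one leaf; then the growth of [D] is replayed through [f]. *)
Lemma grown_attach (V Z : finType) (r x : V) (z : Z) (X : {set V}) E Y D (f : Z -> V) :
  injective f -> (forall w, f w \notin X) -> grown r X E -> x \in X -> grown z Y D ->
  grown r (X :|: f @: Y) (E :|: ([set x; f z] |: map_edges f D)).
Proof.
move=> injf fX g xX; elim=> [|{}Y {}D u v _ IH uY vY].
  rewrite /map_edges imset0 setU0 imset_set1 setUC [E :|: _]setUC; exact: grown_leaf.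
have -> : X :|: f @: (v |: Y) = f v |: (X :|: f @: Y).
  by rewrite imsetU1 setUCA.
have -> : E :|: ([set x; f z] |: map_edges f ([set u; v] |: D)) =
   [set f u; f v] |: (E :|: ([set x; f z] |: map_edges f D)).
  by rewrite /map_edges imsetU1 imsetU1 imset_set1 setUCA [in RHS]setUCA; congr (_ :|: _); rewrite setUCA.
apply: grown_leaf IH _ _; first by rewrite inE imset_f ?orbT.
by rewrite inE negb_or fX mem_imset.
Qed.

(** Greedy embedding: when the leaf [y] is added, fewer than [#|Z|] vertices are occupied, and the
    image of its parent has at least [#|Z|] neighbours in [H]. Values of [f] outside [Y] are
    placeholders, hence injectivity on [Y] only. *)
Lemma grown_embed (V Z : finType) (e : rel V) (H : {set V}) (r : Z) Y D v :
  (forall x, x \in H -> #|Z| <= #|[set y in H | e x y]|)%N -> symmetric e ->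
  v \in H -> grown r Y D ->
  exists f : Z -> V, [/\ {in Y &, injective f}, f r = v,
    forall a, a \in Y -> f a \in H &
    forall a b, [set a; b] \in D -> e (f a) (f b)].
Proof.
move=> degH syme vH; elim=> [|{}Y {}D x y g [f [injf fr fH fD]] xY yY].
  exists (fun=> v); split=> //; last by move=> a b; rewrite inE.
  by move=> a b /set1P -> /set1P ->.
have : (#|f @: Y| < #|[set w in H | e (f x) w]|)%N.
  apply: leq_trans (degH _ (fH _ xY)); rewrite (leq_ltn_trans (leq_imset_card _ _)) //.
  by rewrite -cardsT; apply: proper_card; rewrite properE subsetT; apply/subsetPn; exists y.
move=> lt; have [w] : exists w, w \in [set w in H | e (f x) w] :\: f @: Y.
  apply/set0Pn; apply: contraTneq lt => /eqP; rewrite setD_eq0 => /subset_leq_card.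
  by rewrite leqNgt.
rewrite !inE => /andP[wY /andP[wH xw]].
have ny a : a \in Y -> (a == y) = false by move=> aY; apply: contraNF yY => /eqP <-.
have fw a : a \in Y -> f a <> w by move=> aY ew; rewrite -ew imset_f in wY.
exists (fun z => if z == y then w else f z); split.
- move=> a b /setU1P[->|aY] /setU1P[->|bY] //; rewrite ?eqxx ?ny //.
  + by move=> ew; case: (fw _ bY).
  + by move=> /fw-/(_ aY).
  + exact: injf.
- by rewrite ny // (grown_root g).
- by move=> a /setU1P[->|aY]; rewrite ?eqxx ?ny // fH.
move=> a b; rewrite in_setU1 => /predU1P[eab|Dab]; last first.
  by have /andP[aY bY] := grown_edge g Dab; rewrite !ny // fD.
have xy : x <> y by move=> exy; rewrite -exy xY in yY.
have /set2P[ea|ea] : a \in [set x; y] by rewrite -eab set21.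
  have /set2P[ey|->] : b \in [set x; y] by rewrite -eab set22.
    by have := set22 x y; rewrite -eab ea ey => /set2P[] exy; case: xy.
  by rewrite ea eqxx ny.
have /set2P[->|ey] : b \in [set x; y] by rewrite -eab set22.
  by rewrite ea eqxx ny // syme.
by have := set21 x y; rewrite -eab ea ey => /set2P[] exy; case: xy.
Qed.

(** * Strings of trees *)

Section Strings.
Variables (V : finType) (k : nat).
Implicit Types (phi psi : nat -> 'I_k.+1 -> V) (tau sigma : nat -> {set {set 'I_k.+1}}).

(** [phi i a] is the place of vertex [a] of the [i]-th tree. Rows are indexed by all of [nat] and
    only the first [M] are meaningful, so a search can push or drop a row by changing [M]. *)
Definition string_inj (M : nat) phi : Prop :=
  forall i j a b, (i < M)%N -> (j < M)%N -> phi i a = phi j b -> i = j /\ a = b.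

Definition covered (M : nat) phi : {set V} :=
  [set phi (val p.1) p.2 | p : 'I_M * 'I_k.+1].

Lemma coveredP M phi x :
  reflect (exists i a, (i < M)%N /\ x = phi i a) (x \in covered M phi).
Proof.
apply: (iffP imsetP) => [[[i a] _ ->]|[i [a [iM ->]]]].
  by exists i, a; split.
by exists (Ordinal iM, a).
Qed.

Lemma mem_covered M phi i a : (i < M)%N -> phi i a \in covered M phi.
Proof. by move=> iM; apply/coveredP; exists i, a. Qed.

Lemma covered0 phi : covered 0 phi = set0.
Proof. by apply/setP => x; rewrite inE; apply/coveredP => -[i [a []]]. Qed.

Lemma coveredS M phi : covered M.+1 phi = covered M phi :|: phi M @: setT.
Proof.
apply/setP => x; rewrite inE; apply/coveredP/orP.
  move=> [i [a [+ ->]]]; rewrite ltnS leq_eqVlt => /predU1P[->|iM].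
    by right; rewrite imset_f.
  by left; rewrite mem_covered.
case=> [/coveredP[i [a [iM ->]]]|/imsetP[a _ ->]]; last by exists M, a.
by exists i, a; split=> //; rewrite ltnW.
Qed.

Lemma card_covered M phi : string_inj M phi -> #|covered M phi| = (M * k.+1)%N.
Proof.
move=> inj; rewrite card_imset ?card_prod ?card_ord // => -[i a] [j b] /= eij.
have [eq_ij ->] := inj i j a b (ltn_ord i) (ltn_ord j) eij.
by congr (_, _); apply: val_inj.
Qed.

Definition string_in (e : rel V) (M : nat) tau phi : Prop :=
  [/\ string_inj M phi,
      forall i a b, (i < M)%N -> [set a; b] \in tau i -> e (phi i a) (phi i b) &
      forall i, (i.+1 < M)%N -> e (phi i ord0) (phi i.+1 ord0)].

Lemma string_in_pred e M tau phi : string_in e M.+1 tau phi -> string_in e M tau phi.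
Proof.
move=> [inj rows spine]; split.
- by move=> i j a b iM jM; apply: inj; rewrite ltnW.
- by move=> i a b iM; apply: rows; rewrite ltnW.
- by move=> i iM; apply: spine; rewrite ltnW.
Qed.

Lemma string_in_push e M tau phi (f : 'I_k.+1 -> V) :
  string_in e M tau phi -> injective f -> (forall a, f a \notin covered M phi) ->
  (forall a b, [set a; b] \in tau M -> e (f a) (f b)) ->
  ((0 < M)%N -> e (phi M.-1 ord0) (f ord0)) ->
  string_in e M.+1 tau (fun i => if i == M then f else phi i).
Proof.
move=> [inj rows spine] injf fcov frow fspine; split.
- have ltS l : (l < M.+1)%N -> l = M \/ (l < M)%N.
    by rewrite ltnS leq_eqVlt => /predU1P.
  move=> i j a b /ltS[->|iM] /ltS[->|jM].
  + by rewrite eqxx => /injf.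
  + rewrite eqxx (ltn_eqF jM) => efb.
    by have /negP[] := fcov a; rewrite efb mem_covered.
  + rewrite eqxx (ltn_eqF iM) => efb.
    by have /negP[] := fcov b; rewrite -efb mem_covered.
  + by rewrite (ltn_eqF iM) (ltn_eqF jM); apply: inj.
- move=> i a b; rewrite ltnS leq_eqVlt => /predU1P[->|iM]; first by rewrite eqxx; apply: frow.
  by rewrite (ltn_eqF iM); apply: rows.
- move=> i; rewrite ltnS leq_eqVlt => /predU1P[eM|iM].
    by rewrite -eM eqxx (ltn_eqF (ltnSn i)); move: fspine; rewrite -eM; apply.
  by rewrite (ltn_eqF iM) (ltn_eqF (ltnW iM)); apply: spine.
Qed.

(** * Depth-first search for a string *)

Section Search.
Variables (e : rel V) (m : nat).

Definition deg_dense (H : {set V}) : bool :=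
  [forall x in H, k < #|[set y in H | e x y]|]%N.

Implicit Types W : {set V}.

(** The largest subset of [W] of minimum inner degree above [k]. A tree on [k.+1] vertices embeds
    greedily in it with its root at any chosen vertex. *)
Definition core (W : {set V}) : {set V} :=
  \bigcup_(H : {set V} | (H \subset W) && deg_dense H) H.

Lemma coreP W x :
  reflect (exists2 H : {set V}, (H \subset W) && deg_dense H & x \in H) (x \in core W).
Proof. by apply: (iffP bigcupP) => -[H ? ?]; exists H. Qed.

Lemma core_sub W : core W \subset W.
Proof. by apply/bigcupsP => H /andP[]. Qed.

Lemma core_mono W W' : W' \subset W -> core W' \subset core W.
Proof.
move=> sW; apply/subsetP => x /coreP[H /andP[sH dH] xH].
by apply/coreP; exists H => //; rewrite dH (subset_trans sH).
Qed.

Hypothesis sym_e : symmetric e.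
Hypothesis m_gt0 : (0 < m)%N.
Hypothesis joined : forall A B : {set V}, (m <= #|A|)%N -> (m <= #|B|)%N ->
  [disjoint A & B] -> exists x y, [/\ x \in A, y \in B & e x y].
Hypothesis has_dense : forall B : {set V}, (m <= #|B|)%N ->
  exists H : {set V}, [/\ H \subset B, deg_dense H & H != set0].

(** A nonempty dense set inside [W :\: core W] would belong to the core, so this difference has
    fewer than [m] vertices. *)
Lemma card_core (W : {set V}) : (#|W| < #|core W| + m)%N.
Proof.
have [|] := ltnP #|W :\: core W| m.
  by have := cardsID (core W) W; rewrite (setIidPr (core_sub W)) => <-; rewrite ltn_add2l.
move=> /has_dense[H [sH dH /set0Pn[x xH]]].
have := subsetP sH _ xH; rewrite inE => /andP[/negP[]].
by apply/coreP; exists H; rewrite ?dH ?(subset_trans sH) ?subsetDl.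
Qed.

Variables (M : nat) (tau : nat -> {set {set 'I_k.+1}}).
Hypothesis tau_tree : forall i, is_tree (tau i).
(** Space for a full string, for the rows of [m] abandoned roots, and for [2 * m] unvisited
    vertices, which keeps the core at size at least [m]. *)
Hypothesis room : (k.+1 * M + k.+1 * m + 2 * m <= #|V|)%N.

(* Depth-first search on the spine: a root with no neighbour in the core of the
   unvisited set is abandoned together with its row.  Abandoned roots never see
   the current core, so there are fewer than m of them. *)
Lemma string_search_step (c j : nat) phi (D X : {set V}) :
  let W := ~: (covered j phi :|: X) in
  (2 * #|W| + k.+1 * j <= c)%N -> string_in e j tau phi -> (j <= M)%N ->
  D \subset X -> [disjoint covered j phi & X] -> (#|X| <= k.+1 * #|D|)%N ->
  (#|D| < m)%N -> (forall x y, x \in D -> y \in core W -> ~~ e x y) ->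
  exists phi', string_in e M tau phi'.
Proof.
(* The measure drops in both moves: pushing a row removes [k.+1] vertices from [W], counted twice,
   and raises [j] by one; abandoning a row fixes [W] and lowers [j]. *)
elim: c j phi D X => [|c IH] j phi D X W cW str jM sDX dX cX cD eD;
    have cardW : (2 * m <= #|W|)%N.
- have : (#|W| + #|covered j phi :|: X| = #|V|)%N by rewrite addnC cardsC.
  have [+ _] := leq_card_setU (covered j phi) X.
  rewrite (card_covered (let: And3 h _ _ := str in h)) mulnC.
  have := leq_mul (leqnn k.+1) jM; have := leq_mul (leqnn k.+1) (ltnW cD).
  by move: room cX; clear; lia.
- by move: cW cardW m_gt0; clear; lia.
- have : (#|W| + #|covered j phi :|: X| = #|V|)%N by rewrite addnC cardsC.
  have [+ _] := leq_card_setU (covered j phi) X.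
  rewrite (card_covered (let: And3 h _ _ := str in h)) mulnC.
  have := leq_mul (leqnn k.+1) jM; have := leq_mul (leqnn k.+1) (ltnW cD).
  by move: room cX; clear; lia.
have [ejM|] := eqVneq j M; first by exists phi; rewrite -ejM.
move=> njM; have {njM}jM : (j < M)%N by rewrite ltn_neqAle njM.
have cardC : (m <= #|core W|)%N by have := card_core W; move: cardW; clear; lia.
(* Pushing a row: the next tree is embedded with its root at [y]. The core only shrinks, so the
   abandoned roots in [D] still do not see it. *)
have forward y : y \in core W -> ((0 < j)%N -> e (phi j.-1 ord0) y) ->
    exists phi', string_in e M tau phi'.
  move=> /coreP[H /andP[sHW /forall_inP dH] yH] ey.
  have [|f [injf f0 fH fe]] := grown_embed _ sym_e yH (tree_grown ord0 (tau_tree j)).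
    by move=> x /dH; rewrite card_ord.
  have {}fH a : f a \in W by rewrite (subsetP sHW) ?fH ?inE.
  have {}injf : injective f by move=> a b; apply: injf; rewrite inE.
  have fcov a : f a \notin covered j phi by have := fH a; rewrite !inE negb_or => /andP[].
  set phi' := fun i => if i == j then f else phi i.
  have str' : string_in e j.+1 tau phi'.
    by apply: string_in_push => // j0; rewrite f0 ey.
  have cov' : covered j.+1 phi' = covered j phi :|: f @: setT.
    rewrite coveredS /phi' eqxx; congr (_ :|: _).
    apply/setP => x; apply/coveredP/coveredP => -[i [a [ij ->]]]; exists i, a.
      by rewrite (ltn_eqF ij).
    by rewrite (ltn_eqF ij).
  have sW : ~: (covered j.+1 phi' :|: X) \subset W.
    by rewrite setCS cov' setUAC subsetUl.
  apply: (IH j.+1 phi' D X) => //.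
  - have : ~: (covered j.+1 phi' :|: X) = W :\: f @: setT.
      by rewrite cov' setUAC setCU setDE.
    move=> ->; have := cardsID (f @: setT) W.
    have -> : W :&: f @: setT = f @: setT.
      by apply/setIidPr/subsetP => x /imsetP[a _ ->].
    rewrite card_imset // cardsT card_ord; move: cW; set w := #|W|.
    by set w' := #|W :\: _|; clear; lia.
  - rewrite cov' -setI_eq0 setIUl setU_eq0 setI_eq0 dX /=.
    apply/eqP/setP => x; rewrite !inE; apply/negP => /andP[/imsetP[a _ ->]].
    by have := fH a; rewrite !inE negb_or => /andP[_ /negP].
  - by move=> x y' xD yC; apply: eD => //; apply: (subsetP (core_mono sW)).
(* With no row present there is no last root to continue from, and any vertex of the core may start
   the string. *)
case: j => [|j] in phi W cW str jM dX eD cardW cardC forward *.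
  have /set0Pn[y yC] : core W != set0 by rewrite -card_gt0 (leq_trans m_gt0).
  exact: forward yC _.
have [/existsP[y /andP[yC ey]]|/existsPn noy] := boolP [exists y, (y \in core W) && e (phi j ord0) y].
  exact: forward yC _.
(* Abandoning the last row: its vertices move to [X], so the unvisited set [W] is the same, and its
   root [v] joins [D]. *)
set v := phi j ord0 in noy.
have eW : ~: (covered j phi :|: (X :|: phi j @: setT)) = W.
  by rewrite /W coveredS setUAC setUA.
have vD : v \notin D.
  apply/negP => /(subsetP sDX) vX.
  have /pred0P/(_ v) := dX; rewrite /= vX andbT.
  by rewrite mem_covered.
have eD' x y : x \in v |: D -> y \in core W -> ~~ e x y.
  move=> /setU1P[->|]; last exact: eD.
  by move=> yC; have := noy y; rewrite yC.
have sD' : v |: D \subset X :|: phi j @: setT.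
  by rewrite subUset sub1set inE imset_f ?orbT ?inE //= (subset_trans sDX) ?subsetUl.
apply: (IH j phi (v |: D) (X :|: phi j @: setT)) => //.
- by rewrite eW; move: cW; clear; lia.
- exact: string_in_pred str.
- by rewrite ltnW // ltnW.
- case: str => inj _ _.
  rewrite -setI_eq0 setIUr setU_eq0; apply/andP; split.
    rewrite setI_eq0; apply: disjointWl dX.
    by rewrite coveredS subsetUl.
  apply/eqP/setP => x; rewrite !inE; apply/negP => /andP[/coveredP[i [a [ij ->]]]].
  move=> /imsetP[b _ eij].
  have [|//|eij' _] := inj i j a b _ _ eij; first by rewrite ltnW.
  by rewrite eij' ltnn in ij.
- rewrite cardsU1 vD mulnDr muln1 addnC (leq_trans (leq_card_setU _ _)) // leq_add //.
  by rewrite (leq_trans (leq_imset_card _ _)) // cardsT card_ord.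
(* If the abandoned roots numbered [m], [joined] would give an edge from them to the core. *)
- rewrite ltnNge; apply/negP => mD.
  have [|x [y [xD yC exy]]] := joined mD cardC.
    rewrite -setI_eq0; apply/eqP/setP => x; rewrite !inE; apply/negP => /andP[xD].
    move/(subsetP (core_sub _)); rewrite -eW !inE negb_or => /andP[_ /negP[]].
    by have := subsetP sD' x; rewrite !inE; apply.
  by have := eD' _ _ xD yC; rewrite exy.
- by rewrite eW.
Qed.

Lemma string_search (v0 : V) : exists phi, string_in e M tau phi.
Proof.
apply: (@string_search_step _ 0 (fun _ _ => v0) set0 set0 (leqnn _)) => //.
- by rewrite -setI_eq0 setI0.
- by rewrite cards0.
- by rewrite cards0.
- by move=> x y; rewrite inE.
Qed.

End Search.

End Strings.

(** * Reading a string off a spanning tree *)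

Section Realize.
Variables (V : finType) (k : nat).
Implicit Types (phi psi : nat -> 'I_k.+1 -> V) (tau sigma : nat -> {set {set 'I_k.+1}}).

Definition string_adj tau i a j b : bool :=
  (i == j) && ([set a; b] \in tau i) ||
  [&& a == ord0, b == ord0 & (j == i.+1) || (i == j.+1)].

(** The equality makes the string an induced subgraph of [S], which decoding requires; [string_in]
    only asks that the edges of the string be present. *)
Definition realizes (S : {set {set V}}) (M : nat) tau phi : Prop :=
  string_inj M phi /\
  forall i j a b, (i < M)%N -> (j < M)%N ->
    ([set phi i a; phi j b] \in S) = string_adj tau i a j b.

(** Here [M] is the index of the last row, so the string has [M.+1] rows. *)
Fixpoint string_edges tau phi (M : nat) : {set {set V}} :=
  if M is M'.+1 then
    string_edges tau phi M' :|:
      ([set phi M' ord0; phi M ord0] |: map_edges (phi M) (tau M))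
  else map_edges (phi 0%N) (tau 0%N).

Lemma grown_string M tau phi : (forall i, is_tree (tau i)) -> string_inj M.+1 phi ->
  grown (phi 0%N ord0) (covered M.+1 phi) (string_edges tau phi M).
Proof.
move=> trt; elim: M => [|M IH] inj; rewrite coveredS.
  rewrite covered0 set0U; apply: grown_map; last exact: tree_grown.
  by move=> a b /(inj 0%N 0%N a b isT isT)[].
apply: grown_attach.
- by move=> a b /(inj M.+1 M.+1 a b (ltnSn _) (ltnSn _))[].
- move=> a; apply/coveredP => -[i [b [iM eab]]].
  have [|eMi _] := inj M.+1 i a b (ltnSn _) _ eab; first by rewrite ltnW.
  by rewrite -eMi ltnn in iM.
- by apply: IH => i j a b iM jM; apply: inj; rewrite ltnW.
- by rewrite mem_covered.
- exact: tree_grown.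
Qed.

Lemma map_edgesP (Z : finType) (f : Z -> V) (D : {set {set Z}}) e :
  is_simple_edges D -> e \in map_edges f D ->
  exists a b, e = [set f a; f b] /\ [set a; b] \in D.
Proof.
move=> /forall_inP simD /imsetP[e' De' ->].
have /cards2P[a [b [_ eab]]] := simD _ De'; exists a, b.
by rewrite eab imsetU1 imset_set1 -eab.
Qed.

Lemma mem_map_edges (Z : finType) (f : Z -> V) (D : {set {set Z}}) a b :
  [set a; b] \in D -> [set f a; f b] \in map_edges f D.
Proof. by move=> Dab; apply/imsetP; exists [set a; b]; rewrite // imsetU1 imset_set1. Qed.

Lemma string_edgesP M tau phi e : (forall i, is_tree (tau i)) ->
  e \in string_edges tau phi M ->
  exists i j a b, [/\ (i < M.+1)%N, (j < M.+1)%N, e = [set phi i a; phi j b] &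
    string_adj tau i a j b].
Proof.
move=> trt; have row i a b : [set a; b] \in tau i -> string_adj tau i a i b.
  by rewrite /string_adj eqxx => ->.
elim: M => [|M IH] /=.
  move=> /(map_edgesP (proj1 (trt _)))[a [b [-> Dab]]].
  by exists 0%N, 0%N, a, b; split=> //; apply: row.
rewrite in_setU => /orP[/IH|/setU1P[->|]].
- move=> [i [j [a [b [iM jM -> adj_ij]]]]]; exists i, j, a, b; split=> //; exact: ltnW.
- by exists M, M.+1, ord0, ord0; split=> //; rewrite /string_adj !eqxx orbT.
- move=> /(map_edgesP (proj1 (trt _)))[a [b [-> Dab]]].
  by exists M.+1, M.+1, a, b; split=> //; apply: row.
Qed.

Lemma mem_string_edges M tau phi i j a b : (i < M.+1)%N -> (j < M.+1)%N ->
  string_adj tau i a j b -> [set phi i a; phi j b] \in string_edges tau phi M.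
Proof.
have row N l : (l <= N)%N -> [set a; b] \in tau l ->
    [set phi l a; phi l b] \in string_edges tau phi N.
  elim: N => [|N IH]; first by rewrite leqn0 => /eqP -> /=; apply: mem_map_edges.
  rewrite leq_eqVlt => /predU1P[->|lN] tab; first by rewrite /= !inE mem_map_edges ?orbT.
  by rewrite /= in_setU IH.
have spine N l : (l < N)%N ->
    [set phi l ord0; phi l.+1 ord0] \in string_edges tau phi N.
  elim: N => [//|N IH]; rewrite ltnS leq_eqVlt => /predU1P[->|lN].
    by rewrite /= in_setU setU11 orbT.
  by rewrite /= in_setU IH.
move=> iM jM /orP[/andP[/eqP <-]|]; first exact: row.
case/and3P => /eqP -> /eqP -> /orP[]/eqP e; subst; first exact: spine.
by rewrite setUC; apply: spine.
Qed.

(** The string is itself a grown tree, hence extends to a spanning tree. The latter is acyclic and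
    the string connected, so no further edge appears between covered vertices. *)
Lemma string_spanning (e : rel V) M tau phi :
  symmetric e -> (forall i, is_tree (tau i)) ->
  (forall A : {set V}, A != set0 -> A != setT ->
     exists x y, [/\ x \in A, y \notin A & e x y]) ->
  string_in e M.+1 tau phi ->
  exists S, is_spanning_tree e S /\ realizes S M.+1 tau phi.
Proof.
move=> syme trt cut [inj rows spine].
have edge x y : e x y -> [set x; y] \in edges_of e.
  by move=> exy; apply/imset2P; exists x y; rewrite ?inE.
have g := grown_string trt inj.
have [A rA nA||S [gS sES sSG]] := grown_extend (G := edges_of e) _ g.
- have [|x [y [xA yA exy]]] := cut A _ nA; first by apply/set0Pn; exists (phi 0%N ord0).
  by exists x, y; split=> //; apply: edge.
- apply/subsetP => d /(string_edgesP trt)[i [j [a [b [iM jM -> /orP[]]]]]].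
    by case/andP => /eqP <- tab; apply/edge/rows.
  case/and3P => /eqP -> /eqP -> /orP[]/eqP eij; subst; first exact/edge/spine.
  by rewrite setUC; exact/edge/spine.
have trS := grown_tree gS; exists S; split=> //; split=> // i j a b iM jM.
apply/idP/idP => [Sij|adj_ij]; last exact/(subsetP sES)/mem_string_edges.
case: trS => simS [_ acS].
have nij : phi i a != phi j b.
  by have := forall_inP simS _ Sij; rewrite cards2; case: (eqVneq (phi i a) (phi j b)).
have : [set phi i a; phi j b] \in string_edges tau phi M.
  apply: acyclic_sub_connect acS sES _ nij Sij.
  by apply: grown_connect g _ _; apply: mem_covered.
move=> /(string_edgesP trt)[i' [j' [a' [b' [iM' jM' eij adj_ij]]]]].
(* Edges are unordered pairs, so injectivity identifies the indices only up to a swap. *)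
have adj_ji : string_adj tau j' b' i' a'.
  move: adj_ij; rewrite /string_adj setUC => /orP[/andP[/eqP <- ->]|/and3P[-> -> +]].
    by rewrite eqxx.
  by rewrite orbC => ->; rewrite orbT.
have /set2P[] : phi i a \in [set phi i' a'; phi j' b'] by rewrite -eij set21.
  move=> ei; have [? ?] := inj _ _ _ _ iM iM' ei; subst i' a'.
  have : phi j b \in [set phi i a; phi j' b'] by rewrite -eij set22.
  move=> /set2P[ej|ej]; first by rewrite ej eqxx in nij.
  by have [? ?] := inj _ _ _ _ jM jM' ej; subst.
move=> ei; have [? ?] := inj _ _ _ _ iM jM' ei; subst j' b'.
have : phi j b \in [set phi i' a'; phi i a] by rewrite -eij set22.
move=> /set2P[ej|ej]; last by rewrite ej eqxx in nij.
by have [? ?] := inj _ _ _ _ jM iM' ej; subst.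
Qed.

Definition roots (M : nat) phi : {set V} := [set phi (val i) ord0 | i : 'I_M].

Lemma rootsP M phi x :
  reflect (exists i, (i < M)%N /\ x = phi i ord0) (x \in roots M phi).
Proof.
apply: (iffP imsetP) => [[i _ ->]|[i [iM ->]]]; first by exists i.
by exists (Ordinal iM).
Qed.

(** The first root orients the spine, and the set of roots separates spine edges from the edges
    inside the rows. *)
Lemma realizes_unique S M tau sigma phi psi :
  (forall i, is_tree (tau i)) -> (forall i, is_tree (sigma i)) ->
  realizes S M tau phi -> realizes S M sigma psi ->
  covered M phi = covered M psi -> roots M phi = roots M psi ->
  phi 0%N ord0 = psi 0%N ord0 ->
  forall i, (i < M)%N -> tree_iso (tau i) (sigma i).
Proof.
move=> trt trs [injphi adjphi] [injpsi adjpsi] ecov eroots e0.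
(* The next root of [phi] is some root of [psi] adjacent in [S] to the current one, so it is the
   next or the previous root of [psi]; the latter is already taken by an earlier root of [phi]. *)
have spine i : (i < M)%N -> phi i ord0 = psi i ord0.
  elim/ltn_ind: i => -[//|i] IH iM.
  have : phi i.+1 ord0 \in roots M psi by rewrite -eroots; apply/rootsP; exists i.+1.
  move=> /rootsP[j [jM ej]].
  have : string_adj sigma i ord0 j ord0.
    rewrite -adjpsi // 1?ltnW // -ej -IH // 1?ltnW // adjphi // 1?ltnW //.
    by rewrite /string_adj !eqxx orbT.
  case/orP => [/andP[/eqP eij _]|].
    subst j; rewrite -IH // in ej.
    by have [] := injphi _ _ _ _ iM jM ej; lia.
  rewrite !eqxx /= => /orP[]/eqP eij; first by rewrite ej eij.
  rewrite -IH // in ej; last by rewrite eij; lia.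
  by have [] := injphi _ _ _ _ iM jM ej; lia.
move=> i iM.
(* Otherwise some edge of [tau i] leaves the set [B] of vertices landing in row [i] of [psi]. If it
   changes rows of [psi] it is a spine edge, so its far end is a root, hence the root of row [i] of
   [phi], which lies in [B]. *)
have row a : exists b, phi i a = psi i b.
  have [//|na] := pselect (exists b, phi i a = psi i b).
  pose B := [set c | `[< exists b, phi i c = psi i b >]].
  have B0 : ord0 \in B by rewrite inE; apply/asboolP; exists ord0; exact: spine.
  have Ba : a \notin B by rewrite inE; apply/asboolPn.
  have [_ [con _]] := trt i.
  have [u [v [+ + uv]]] := connect_cut (con ord0 a) B0 Ba.
  rewrite !inE => /asboolP[b eub] /asboolPn[].
  have Suv : [set phi i u; phi i v] \in S by rewrite adjphi // /string_adj eqxx (uv : [set u; v] \in tau i).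
  have := mem_covered phi v iM; rewrite ecov => /coveredP[j [b' [jM evb]]].
  have : string_adj sigma i b j b' by rewrite -adjpsi // -eub -evb.
  case/orP => [/andP[/eqP eij _]|]; first by exists b'; rewrite evb eij.
  case/and3P => _ /eqP eb' _; rewrite eb' in evb.
  have : phi i v \in roots M phi by rewrite eroots; apply/rootsP; exists j.
  move=> /rootsP[l [lM evl]]; have [_ ev] := injphi _ _ _ _ iM lM evl.
  by exists ord0; rewrite ev; exact: spine.
have /choice[h hP] := row.
have injh : injective h.
  by move=> a b eab; have [] := injphi i i a b iM iM; rewrite // !hP eab.
exists (perm injh) => u v; rewrite !permE.
have loc rho a b : string_adj rho i a i b = ([set a; b] \in rho i).
  by rewrite /string_adj eqxx (ltn_eqF (ltnSn i)) /= !andbF orbF.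
by rewrite -!loc -adjphi // -adjpsi // !hP.
Qed.

Lemma realizes_iso (S S' : {set {set V}}) M tau phi (s : {perm V}) :
  (forall u v, ([set u; v] \in S) = ([set s u; s v] \in S')) ->
  realizes S M tau phi -> realizes S' M tau (fun i a => s (phi i a)).
Proof.
move=> iso [inj adjS]; split=> [i j a b iM jM /perm_inj|i j a b iM jM]; first exact: inj.
by rewrite -iso adjS.
Qed.

End Realize.

(** * Isomorphism classes and the count of strings *)

Lemma tree_iso_refl (V : finType) (T : {set {set V}}) : tree_iso T T.
Proof. by exists 1%g => u v; rewrite !perm1. Qed.

Lemma tree_iso_sym (V : finType) (T T' : {set {set V}}) : tree_iso T T' -> tree_iso T' T.
Proof. by case=> s sP; exists s^-1%g => u v; rewrite sP !permKV. Qed.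

Lemma tree_iso_trans (V : finType) (T1 T2 T3 : {set {set V}}) :
  tree_iso T1 T2 -> tree_iso T2 T3 -> tree_iso T1 T3.
Proof. by move=> [s sP] [t tP]; exists (s * t)%g => u v; rewrite !permM sP tP. Qed.

Lemma iso_class_eq (V : finType) (P : {set {set V}} -> Prop) T T' :
  tree_iso T T' -> iso_class P T = iso_class P T'.
Proof.
move=> iso; apply/setP => X; rewrite !inE; apply: asbool_equiv_eq; split=> -[PX].
  by move=> TX; split=> //; apply: tree_iso_trans TX; apply: tree_iso_sym.
by move=> TX; split=> //; apply: tree_iso_trans TX.
Qed.

(** The class of a [T] satisfying [P] contains [T], so the default [set0] is not returned for it. *)
Definition class_repr (V : finType) (c : {set {set {set V}}}) : {set {set V}} :=
  odflt set0 [pick T in c].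

Lemma class_reprP (V : finType) (P : {set {set V}} -> Prop) T :
  P T -> P (class_repr (iso_class P T)) /\ tree_iso T (class_repr (iso_class P T)).
Proof.
move=> PT; rewrite /class_repr; case: pickP => [T'|/(_ T)].
  by rewrite inE => /asboolP.
by rewrite inE => /asboolPn[]; split=> //; apply: tree_iso_refl.
Qed.

Lemma card_le_rel (I J : finType) (A : {set I}) (B : {set J}) (r : I -> J -> Prop) :
  (forall i, i \in A -> exists2 j, j \in B & r i j) ->
  (forall i i' j, i \in A -> i' \in A -> r i j -> r i' j -> i = i') ->
  (#|A| <= #|B|)%N.
Proof.
move=> ex inj.
have [A0|/set0Pn[i0 Ai0]] := eqVneq A set0; first by rewrite A0 cards0.
have [j0 _ _] := ex _ Ai0.
have /choice[f fP] : forall i, exists j, i \in A -> (j \in B) /\ r i j.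
  move=> i; have [Ai|nAi] := boolP (i \in A); last by exists j0.
  by have [j ? ?] := ex _ Ai; exists j.
have injf : {in A &, injective f}.
  move=> i i' Ai Ai' eff; apply: (inj _ _ _ Ai Ai' (proj2 (fP _ Ai))).
  by rewrite eff; apply: (proj2 (fP _ Ai')).
rewrite -(card_in_imset injf); apply/subset_leq_card/subsetP => _ /imsetP[i Ai ->].
exact: (proj1 (fP _ Ai)).
Qed.

(** A sequence of tree classes is encoded by the class of a spanning tree realizing it, the
    uncovered set, the set of roots and the first root; [realizes_unique] decodes it. *)
Lemma count_strings (V : finType) (k M : nat) (e : rel V) :
  (forall tau : nat -> {set {set 'I_k.+1}}, (forall i, is_tree (tau i)) ->
     exists phi S, is_spanning_tree e S /\ realizes S M.+1 tau phi) ->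
  (num_unlabelled_trees k.+1 ^ M.+1 <=
   num_unlabelled_spanning_trees e *
   (#|[set U : {set V} | #|U| <= #|V| - M.+1 * k.+1]| *
   (#|[set U : {set V} | #|U| <= M.+1]| * #|V|)))%N.
Proof.
move=> ex; rewrite /num_unlabelled_trees /num_unlabelled_spanning_trees /num_classes.
set C := [set iso_class _ T | T in _]; set C' := [set iso_class _ T | T in _].
set UU := [set U | _]; set RR := [set U : {set V} | (#|U| <= M.+1)%N].
rewrite -cardsT -!cardsX -[X in (_ ^ X)%N]card_ord -card_ffun_on -[X in (X <= _)%N]cardsE.
(* [inord] extends the sequence to all of [nat], so that every [tau c i] is a tree. *)
pose tau (c : {ffun 'I_M.+1 -> {set {set {set 'I_k.+1}}}}) i := class_repr (c (inord i)).
have classP c : c \in C -> is_tree (class_repr c) /\ iso_class (@is_tree _) (class_repr c) = c.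
  move=> /imsetP[T]; rewrite inE => /asboolP trT ->.
  have [tr iso] := class_reprP trT; split=> //.
  by apply: iso_class_eq; apply: tree_iso_sym.
have trt c : c \in ffun_on C -> forall i, is_tree (tau c i).
  by move=> /ffun_onP cC i; have [] := classP _ (cC (inord i)).
pose r (c : {ffun 'I_M.+1 -> {set {set {set 'I_k.+1}}}})
    (x : {set {set {set V}}} * ({set V} * ({set V} * V))) :=
  exists phi, [/\ realizes (class_repr x.1) M.+1 (tau c) phi,
    x.2.1 = ~: covered M.+1 phi, x.2.2.1 = roots M.+1 phi & x.2.2.2 = phi 0%N ord0].
apply: (@card_le_rel _ _ _ _ r) => [c|c c' x].
  rewrite inE => cC; have [phi [S [spS rS]]] := ex _ (trt _ cC).
  have [_ [s sP]] := class_reprP spS.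
  (* The string is carried over to the chosen representative of the class of [S], so that the class
     alone fixes the tree to decode from. *)
  have rS' := realizes_iso sP rS.
  set psi := (fun i a => s (phi i a)) in rS'.
  exists (iso_class (is_spanning_tree e) S,
    (~: covered M.+1 psi, (roots M.+1 psi, psi 0%N ord0))); last by exists psi.
  rewrite !inE /= andbT; apply/and3P; split.
  - by apply/imsetP; exists S; rewrite // inE; apply/asboolP.
  - by rewrite -(card_covered (proj1 rS')) -(cardsC (covered M.+1 psi)) addKn.
  - by rewrite (leq_trans (leq_imset_card _ _)) // card_ord.
rewrite !inE => cC cC' [phi [rphi e1 e2 e3]] [psi [rpsi e1' e2' e3']].
have iso := realizes_unique (trt _ cC) (trt _ cC') rphi rpsi.
have {}iso i : (i < M.+1)%N -> tree_iso (tau c i) (tau c' i).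
  by apply: iso; rewrite -?e2 -?e3 // -[LHS]setCK -e1 e1' setCK.
apply/ffunP => i; have := iso _ (ltn_ord i); rewrite /tau inord_val => {}iso.
have /ffun_onP/(_ i) cCi := cC; have /ffun_onP/(_ i) cCi' := cC'.
rewrite -(proj2 (classP _ cCi)) -(proj2 (classP _ cCi')).
exact: iso_class_eq.
Qed.

(** * Expander mixing *)

Lemma char_poly_conj (F : fieldType) n (P A : 'M[F]_n) : P \in unitmx ->
  char_poly (invmx P *m A *m P) = char_poly A.
Proof.
move=> uP; rewrite /char_poly.
have -> : char_poly_mx (invmx P *m A *m P) =
    map_mx polyC (invmx P) *m char_poly_mx A *m map_mx polyC P.
  rewrite /char_poly_mx mulmxBr mulmxBl -!map_mxM; congr (_ - _).
  by rewrite mul_mx_scalar -scalemxAl -map_mxM mulVmx // map_mx1 scalemx1.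
rewrite !det_mulmx mulrAC -det_mulmx -map_mxM mulVmx // map_mx1 det1 mul1r //.
Qed.

Lemma sum_set_set (R : nzRingType) (n : nat) (A : 'M[R]_n) (X : {set 'I_n}) :
  ((\row_i (i \in X)%:R) *m A *m (\row_i (i \in X)%:R)^T) 0 0 =
  \sum_(x in X) \sum_(y in X) A x y.
Proof.
rewrite mxE exchange_big [RHS]big_mkcond; apply: eq_bigr => y _ /=.
rewrite !mxE; case: (y \in X); last by rewrite mulr0.
rewrite mulr1 [RHS]big_mkcond; apply: eq_bigr => x _; rewrite mxE.
by case: (x \in X); rewrite ?mul1r ?mul0r.
Qed.

Section Mixing.
Local Open Scope sesquilinear_scope.
Variables (R : realType) (n d : nat) (lam : R) (e : rel 'I_n).
Hypothesis ndl : ndl_graph d lam e.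
Hypothesis lam_lt : lam < d%:R.

Local Notation C := R[i].
Local Notation toC := (real_complex R).
Let AC : 'M[C]_n := adj_matrix C e.

Let sym_e : symmetric e. Proof. by have [[]] := ndl. Qed.

(** A real symmetric matrix is unitarily diagonalizable over [R[i]]. Comparing characteristic
    polynomials identifies the diagonal with the given list of eigenvalues up to order. *)
Lemma adj_matrix_spectral :
  exists (P : 'M[C]_n) (D : 'rV[C]_n) (j0 : 'I_n),
  [/\ P \is unitarymx, AC = invmx P *m diag_mx D *m P, D 0 j0 = d%:R &
      forall j, j != j0 -> `|D 0 j| <= toC lam].
Proof.
have ACE : AC = map_mx toC (adj_matrix R e).
  by apply/matrixP => i j; rewrite !mxE; case: (e i j); rewrite ?rmorph1 ?rmorph0.
have normAC : AC \is normalmx.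
  apply/hermitian_normalmx/realsym_hermsym.
    by apply/is_hermitianmxP; rewrite expr0 scale1r; apply/matrixP => i j; rewrite !mxE sym_e.
  by apply/mxOverP => i j; rewrite mxE realn.
have specE := orthomx_spectralP normAC.
have uP := spectral_unitarymx AC; have uPu := spectral_unit AC.
set P := spectralmx AC in specE uP uPu; set D := spectral_diag AC in specE.
have [_ [_ [s [[ss sorts] cps s0 s1 sn]]]] := ndl.
have /prod_XsubC_eq pD : \prod_(x <- map toC s) ('X - x%:P) =
    \prod_(x <- map (D 0) (enum 'I_n)) ('X - x%:P).
  rewrite big_map [RHS]big_map big_enum /= -(map_prod_XsubC toC) -cps map_char_poly -ACE specE.
  rewrite char_poly_conj // char_poly_trig ?diag_mx_is_trig //.
  by apply: eq_bigr => i _; rewrite mxE eqxx mulr1n.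
(* For an empty list the default value 0 gives [d = 0] and [0 <= lam], against [lam < d]. *)
case: s => [|d' s] in ss sorts cps s0 s1 sn pD *.
  have d0 : d = 0%N by apply/eqP; rewrite -(eqr_nat R) -s0.
  by move: s1 lam_lt; rewrite d0 /=; lra.
rewrite /= in s0; subst d'.
have : toC d%:R \in map (D 0) (enum 'I_n) by rewrite -(perm_mem pD) inE eqxx.
move=> /mapP[j0 _ ej0]; exists P, D, j0; split=> //; first by rewrite -ej0 rmorph_nat.
move=> j jj0.
(* Removing one occurrence of [d] on both sides leaves the tail of the list, whose members lie
   between its last and its second eigenvalue. *)
have : perm_eq (map toC s) (map (D 0) (rem j0 (enum 'I_n))).
  rewrite -(perm_cons (toC d%:R)) (perm_trans pD) // ej0 -map_cons perm_map //.
  by apply: perm_to_rem; rewrite mem_enum.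
move=> /perm_mem/(_ (D 0 j)); rewrite [X in _ = X](_ : _ = true); last first.
  by apply: map_f; rewrite mem_rem_uniq ?enum_uniq // inE jj0 mem_enum.
move=> /mapP[z zs ->].
rewrite -[`|_|]/(`|toC z|).
have -> : `|toC z| = toC `|z|.
  by rewrite normc_def /= expr0n /= addr0 sqrtr_sqr.
rewrite lecR ler_norml.
have [i si zE] := nthP 0 zs; rewrite -zE.
have rtr : transitive (fun x y : R => y <= x) by move=> x y t /[swap]; apply: le_trans.
have mono := sorted_leq_nth rtr (lexx) 0 sorts.
have := mono 1%N i.+1; rewrite !inE /= !ltnS => /(_ _ si isT) h1.
have := mono i.+1 (size s); rewrite !inE /= !ltnS => /(_ si (leqnn _) si) h2.
move: s1 sn; rewrite -ss /= => s1 sn.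
have := h1 (leq_ltn_trans (leq0n _) si) => {}h1.
by rewrite (le_trans h1 s1) andbT (le_trans _ h2) // lerNl; move: sn; rewrite ler_norml; lra.
Qed.

(** The indicator of [X] is expanded in the eigenbasis. The all-ones vector has only a [j0]
    coordinate, so this coordinate yields the main term exactly and the others contribute at most
    [lam] times the squared norm. *)
Lemma mixing (X : {set 'I_n}) :
  `| (\sum_(x in X) \sum_(y in X) (e x y)%:R) - d%:R * #|X|%:R ^+ 2 / n%:R | <=
  lam * #|X|%:R.
Proof.
have [P [D [j0 [uP ACE Dj0 Dj]]]] := adj_matrix_spectral.
have uPu := unitarymx_unit uP.
have n0 : (0 < n)%N := leq_ltn_trans (leq0n _) (ltn_ord j0).
pose x : 'rV[C]_n := \row_i (i \in X)%:R.
pose o : 'rV[C]_n := const_mx 1.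
pose y := x *m invmx P; pose w := o *m invmx P.
have isom (u v : 'rV[C]_n) : u *m v^t* = (u *m invmx P) *m (v *m invmx P)^t*.
  rewrite (invmx_unitary uP) trmx_mul map_mxM /= mulmxA -(mulmxA u).
  by rewrite trmxCK -(invmx_unitary uP) mulVmx // mulmx1.
have oA : o *m AC = d%:R *: o.
  apply/matrixP => i j; rewrite !mxE mulr1 -[d]((proj1 (proj2 ndl)) j).
  rewrite -sum1_card natr_sum big_mkcond [RHS]big_mkcond /=; apply: eq_bigr => z _.
  by rewrite !mxE mul1r inE sym_e; case: (e j z).
(* Comparing coordinates in the eigenvector equation, [D 0 j] would equal [d], yet its norm is at
   most [lam < d]. *)
have wD j : j != j0 -> w 0 j = 0.
  move=> jj0; have : w *m diag_mx D = d%:R *: w.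
    by rewrite /w scalemxAl -oA ACE !mulmxA mulmxK.
  move=> /matrixP/(_ 0 j); rewrite mul_mx_diag !mxE => /eqP.
  rewrite mulrC -subr_eq0 -mulrBl mulf_eq0 => /orP[|/eqP]; last by [].
  rewrite subr_eq0 => /eqP eD; have := Dj _ jj0; rewrite eD.
  rewrite ger0_norm ?ler0n // -[d%:R](rmorph_nat toC) lecR leNgt.
  by rewrite lam_lt.
have dot (u v : 'rV[C]_n) : (u *m v^t*) 0 0 = \sum_j u 0 j * (v 0 j)^*.
  by rewrite mxE; apply: eq_bigr => j _; rewrite !mxE.
have realx i : (x 0 i)^* = x 0 i by rewrite mxE; case: (_ \in _); rewrite ?rmorph1 ?rmorph0.
have xx : \sum_j `|y 0 j| ^+ 2 = #|X|%:R.
  have := dot y y; rewrite -isom dot => exx.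
  under eq_bigr do rewrite normCK; rewrite -exx.
  rewrite -sum1_card natr_sum [RHS]big_mkcond /=; apply: eq_bigr => j _.
  by rewrite realx mxE; case: (_ \in _); rewrite ?mulr1 ?mulr0.
have xo : y 0 j0 * (w 0 j0)^* = #|X|%:R.
  have := dot y w; rewrite -isom dot [RHS](bigD1 j0) //= [X in _ = _ + X]big1; last first.
    by move=> j jj0; rewrite (wD _ jj0) rmorph0 mulr0.
  rewrite addr0 => <-.
  rewrite -sum1_card natr_sum [RHS]big_mkcond /=; apply: eq_bigr => j _.
  by rewrite !mxE rmorph1 mulr1; case: (_ \in _).
have wn : `|w 0 j0| ^+ 2 = n%:R.
  have := dot w w; rewrite -isom dot [RHS](bigD1 j0) //= [X in _ = _ + X]big1; last first.
    by move=> j jj0; rewrite (wD _ jj0) mul0r.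
  rewrite addr0 -normCK => <-.
  under eq_bigr do rewrite !mxE rmorph1 mulr1.
  by rewrite sumr_const card_ord.
have yj0 : `|y 0 j0| ^+ 2 = #|X|%:R ^+ 2 / n%:R.
  have n0C : n%:R != 0 :> C by rewrite pnatr_eq0 -lt0n.
  apply: (mulIf n0C); rewrite divfK // -wn -exprMn -[in RHS]xo.
  by rewrite -(norm_conjC (w 0 j0)) -normrM xo normr_nat.
have quad : \sum_(u in X) \sum_(v in X) (e u v)%:R = \sum_j D 0 j * `|y 0 j| ^+ 2 :> C.
  have := sum_set_set AC X; rewrite -/x => exA.
  transitivity ((x *m AC *m x^T) 0 0).
    by rewrite exA; apply: eq_bigr => u _; apply: eq_bigr => v _; rewrite mxE.
  have -> : x^T = x^t* by apply/matrixP => i j; rewrite !mxE; case: (_ \in _); rewrite ?rmorph1 ?rmorph0.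
  rewrite isom dot ACE !mulmxA mulmxK //; apply: eq_bigr => j _.
  by rewrite mul_mx_diag mxE normCK mulrCA mulrA.
rewrite -lecR.
have -> : toC `|(\sum_(u in X) \sum_(v in X) (e u v)%:R) - d%:R * #|X|%:R ^+ 2 / n%:R| =
   `|\sum_(u in X) \sum_(v in X) (e u v)%:R - d%:R * #|X|%:R ^+ 2 / n%:R|.
  set z := (X in toC `|X|).
  have -> : toC `|z| = `|toC z| by rewrite normc_def /= expr0n /= addr0 sqrtr_sqr.
  congr `|_|; rewrite /z rmorphB rmorph_sum fmorph_div rmorphM rmorphXn !rmorph_nat.
  congr (_ - _); apply: eq_bigr => u _; rewrite rmorph_sum; apply: eq_bigr => v _.
  by rewrite rmorph_nat.
rewrite quad (bigD1 j0) //= Dj0 yj0 mulrA addrAC subrr add0r.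
rewrite (le_trans (ler_norm_sum _ _ _)) // rmorphM rmorph_nat -xx mulr_sumr.
rewrite [leRHS](bigD1 j0) //= -[leLHS]add0r lerD //.
  apply: mulr_ge0; last by rewrite exprn_ge0.
  rewrite -[0]/(toC 0) lecR.
  by have [_ [_ [s [_ _ _ _ ]]]] := ndl; apply: le_trans.
by apply: ler_sum => j jj0; rewrite normrM normrX normr_id ler_wpM2r ?exprn_ge0 // Dj.
Qed.

End Mixing.

(** * Dense subsets, joined sets and cuts in an expander *)

(** A vertex with at most [k] neighbours in [B] can be peeled off repeatedly. Ordered pairs are
    counted, so each one costs at most [2 * k]. *)
Lemma sparse_of_no_dense (V : finType) (e : rel V) (k : nat) (B : {set V}) :
  symmetric e ->
  (forall H : {set V}, H \subset B -> deg_dense k e H -> H = set0) ->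
  (\sum_(x in B) \sum_(y in B) e x y <= 2 * k * #|B|)%N.
Proof.
move=> sym_e; move: {2}#|B| (erefl #|B|) => b; elim: b B => [|b IH] B cB nodense.
  by move/eqP: cB; rewrite cards_eq0 => /eqP ->; rewrite big_set0.
have : ~~ deg_dense k e B.
  apply/negP => /nodense-/(_ (subxx _)) B0; by rewrite B0 cards0 in cB.
rewrite negb_forall => /existsP[x]; rewrite negb_imply -leqNgt => /andP[xB degx].
have degE : (#|[set y in B | e x y]| = \sum_(y in B) e x y)%N.
  rewrite -sum1_card big_mkcond [RHS]big_mkcond; apply: eq_bigr => y _.
  by rewrite inE; case: (y \in B) => //=; case: (e x y).
have {IH}IH : (\sum_(u in B :\ x) \sum_(y in B :\ x) e u y <= 2 * k * #|B :\ x|)%N.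
  apply: IH; first by move: cB; rewrite (cardsD1 x) xB => -[].
  by move=> H sH; apply: nodense; apply: subset_trans sH (subsetDl _ _).
rewrite (big_setD1 x) //= (cardsD1 x) xB -degE.
have -> : (\sum_(u in B :\ x) \sum_(y in B) e u y =
    \sum_(u in B :\ x) e u x + \sum_(u in B :\ x) \sum_(y in B :\ x) e u y)%N.
  by rewrite -big_split; apply: eq_bigr => u _; rewrite (big_setD1 x).
have : (\sum_(u in B :\ x) e u x <= #|[set y in B | e x y]|)%N.
  rewrite degE [leqRHS](big_setD1 x) //= (eq_bigr (fun u => e x u : nat)) ?leq_addl //.
  by move=> u _; rewrite sym_e.
move: degx IH; clear; lia.
Qed.

Section Expansion.
Variables (R : realType) (n d k m : nat) (lam : R) (e : rel 'I_n).
Hypothesis ndl : ndl_graph d lam e.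
Hypothesis m_le_n : (m <= n)%N.
(** Divided by [n]: the average inner degree [d * m / n] expected in a set of [m] vertices exceeds
    [2 * (lam + k)], which covers the mixing error and the degree [2 * k] of a set without dense
    subsets. *)
Hypothesis gap : 2 * (lam + k%:R) * n%:R < d%:R * m%:R.

Lemma ndl_sym : symmetric e. Proof. by have [[]] := ndl. Qed.

Lemma ndl_lam_ge0 : 0 <= lam.
Proof. by have [_ [_ [s [_ _ _ _ ]]]] := ndl; apply: le_trans. Qed.

Lemma ndl_n_gt0 : 0 < n%:R :> R.
Proof.
rewrite ltr0n lt0n; apply/eqP => n0; move: gap m_le_n; rewrite n0 leqn0 => /[swap] /eqP ->.
by rewrite !mulr0 ltxx.
Qed.

Lemma ndl_gap : 2 * lam < d%:R.
Proof.
have n0 := ndl_n_gt0; have l0 := ndl_lam_ge0.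
rewrite -(ltr_pM2r n0).
have h1 : d%:R * m%:R <= d%:R * n%:R :> R by rewrite ler_wpM2l ?ler0n ?ler_nat.
have h2 : 0 <= k%:R * n%:R :> R by rewrite mulr_ge0.
by move: gap; lra.
Qed.

Let lam_lt : lam < d%:R.
Proof. by have := ndl_gap; have := ndl_lam_ge0; lra. Qed.

Definition edges_in (X : {set 'I_n}) : R := \sum_(x in X) \sum_(y in X) (e x y)%:R.

Lemma edges_in_bound (X : {set 'I_n}) :
  d%:R * #|X|%:R ^+ 2 - lam * n%:R * #|X|%:R <= edges_in X * n%:R /\
  edges_in X * n%:R <= d%:R * #|X|%:R ^+ 2 + lam * n%:R * #|X|%:R.
Proof.
have n0 := ndl_n_gt0.
have := mixing ndl lam_lt X; rewrite -/(edges_in X) ler_norml => /andP[h1 h2].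
have h3 : edges_in X * n%:R - d%:R * #|X|%:R ^+ 2 =
    (edges_in X - d%:R * #|X|%:R ^+ 2 / n%:R) * n%:R.
  by rewrite mulrBl divfK // lt0r_neq0.
split.
  have : - (lam * #|X|%:R) * n%:R <= edges_in X * n%:R - d%:R * #|X|%:R ^+ 2.
    by rewrite h3 ler_wpM2r // ltW.
  by lra.
have : edges_in X * n%:R - d%:R * #|X|%:R ^+ 2 <= (lam * #|X|%:R) * n%:R.
  by rewrite h3 ler_wpM2r // ltW.
by lra.
Qed.

(** Without edges between them, the counts inside [A] and [B] add up to that of the union. With a
    and b the sizes, mixing for the three sets gives d a b <= lam n (a + b), while a, b >= m and
    [gap] give the opposite. *)
Lemma ndl_joined (A B : {set 'I_n}) : (m <= #|A|)%N -> (m <= #|B|)%N ->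
  [disjoint A & B] -> exists x y, [/\ x \in A, y \in B & e x y].
Proof.
move=> mA mB dAB; apply: contrapT => noedge.
have no x y : x \in A -> y \in B -> e x y = false.
  by move=> xA yB; apply/negP => exy; apply: noedge; exists x, y.
have split_sum (F : 'I_n -> R) :
    \sum_(x in A :|: B) F x = \sum_(x in A) F x + \sum_(x in B) F x.
  by rewrite -bigU //; apply: eq_bigl => x; rewrite !inE.
have eAB : edges_in (A :|: B) = edges_in A + edges_in B.
  rewrite /edges_in split_sum; congr (_ + _); apply: eq_bigr => x xX; rewrite split_sum.
    by rewrite [X in _ + X]big1 ?addr0 // => y yB; rewrite no.
  by rewrite [X in X + _]big1 ?add0r // => y yA; rewrite ndl_sym no.
have cAB : #|A :|: B| = (#|A| + #|B|)%N.
  by apply/eqP; rewrite (leq_card_setU A B).2.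
have [hAB _] := edges_in_bound (A :|: B); have [_ hA] := edges_in_bound A.
have [_ hB] := edges_in_bound B.
move: hAB hA hB; rewrite eAB cAB natrD.
have n0 := ndl_n_gt0; have l0 := ndl_lam_ge0.
have a0 : 0 <= #|A|%:R :> R by []. have b0 : 0 <= #|B|%:R :> R by [].
have m1 : m%:R <= #|A|%:R :> R by rewrite ler_nat.
have m2 : m%:R <= #|B|%:R :> R by rewrite ler_nat.
have d0 : 0 <= d%:R :> R by [].
have m0 : 0 < m%:R :> R.
  rewrite ltr0n lt0n; apply/eqP => em; move: gap; rewrite em mulr0.
  have := mulr_ge0 l0 (ltW n0); have := mulr_ge0 (ler0n R k) (ltW n0); lra.
have k0 : 0 <= k%:R * n%:R :> R by rewrite mulr_ge0.
move: gap m0 m1 m2 a0 b0 d0 k0; set a := #|A|%:R; set b := #|B|%:R => gap' m0 m1 m2 a0 b0 d0 k0 hAB hA hB.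
have ab : 0 < a + b by lra.
have h1 : d%:R * m%:R * b <= d%:R * a * b by rewrite ler_wpM2r // ler_wpM2l.
have h2 : d%:R * m%:R * a <= d%:R * b * a by rewrite ler_wpM2r // ler_wpM2l.
have h3 : 2 * (lam + k%:R) * n%:R * (a + b) < d%:R * m%:R * (a + b) by rewrite ltr_pM2r.
have h4 : 0 <= k%:R * n%:R * (a + b) by rewrite mulr_ge0 // ltW.
have h5 : 2 * (d%:R * a * b) <= 2 * (lam * n%:R * (a + b)) by move: hAB hA hB; lra.
move: h1 h2 h3 h4 h5; lra.
Qed.

(** Otherwise peeling bounds the inner average degree of [B] by [2 * k], below the value guaranteed
    by mixing. *)
Lemma ndl_has_dense (B : {set 'I_n}) : (m <= #|B|)%N ->
  exists H : {set 'I_n}, [/\ H \subset B, deg_dense k e H & H != set0].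
Proof.
move=> mB; apply: contrapT => nodense.
have := @sparse_of_no_dense _ e k B ndl_sym.
have -> : (forall H : {set 'I_n}, H \subset B -> deg_dense k e H -> H = set0) = True.
  apply/propext; split=> // _ H sH dH; apply/eqP/negPn/negP => nH.
  by apply: nodense; exists H.
move=> /(_ I); rewrite -(ler_nat R) !natrM natr_sum.
rewrite (eq_bigr (fun x => \sum_(y in B) (e x y)%:R)); last by move=> x _; rewrite natr_sum.
rewrite -/(edges_in B) => up.
have [lo _] := edges_in_bound B.
have n0 := ndl_n_gt0; have l0 := ndl_lam_ge0.
have m1 : m%:R <= #|B|%:R :> R by rewrite ler_nat.
have d0 : 0 <= d%:R :> R by [].
have m0 : 0 < m%:R :> R.
  rewrite ltr0n lt0n; apply/eqP => em; move: gap; rewrite em mulr0.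
  have := mulr_ge0 l0 (ltW n0); have := mulr_ge0 (ler0n R k) (ltW n0); lra.
move: up lo m1; set b := #|B|%:R; set E := edges_in B => up lo m1.
have b0 : 0 < b by lra.
have h1 : E * n%:R <= 2 * k%:R * b * n%:R by rewrite ler_wpM2r // ltW.
have h2 : d%:R * m%:R * b <= d%:R * b * b by rewrite ler_wpM2r ?ler_wpM2l // ltW.
have h3 : 2 * (lam + k%:R) * n%:R * b < d%:R * m%:R * b by rewrite ltr_pM2r.
have h4 : 0 <= lam * n%:R * b by rewrite !mulr_ge0 // ltW.
move: lo h1 h2 h3 h4; lra.
Qed.

(** If no edge leaves [A], both [A] and its complement have inner degree [d]. Adding the two mixing
    upper bounds gives d <= 2 lam, against [ndl_gap]. *)
Lemma ndl_cut (A : {set 'I_n}) : A != set0 -> A != setT ->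
  exists x y, [/\ x \in A, y \notin A & e x y].
Proof.
move=> A0 AT; apply: contrapT => noedge.
have no x y : x \in A -> y \notin A -> e x y = false.
  by move=> xA yA; apply/negP => exy; apply: noedge; exists x, y.
have inner (X : {set 'I_n}) : (forall x y, x \in X -> y \notin X -> e x y = false) ->
    edges_in X = d%:R * #|X|%:R.
  move=> noX; rewrite /edges_in -sum1_card natr_sum mulr_sumr; apply: eq_bigr => x xX.
  rewrite mulr1 -((proj1 (proj2 ndl)) x) -sum1_card natr_sum big_mkcond [RHS]big_mkcond /=.
  apply: eq_bigr => y _; rewrite inE; have [yX|yX] := boolP (y \in X); first by case: (e x y).
  by rewrite noX.
have e1 := inner A no.
have e2 : edges_in (~: A) = d%:R * #|~: A|%:R.
  by apply: inner => x y; rewrite !inE negbK => xA yA; rewrite ndl_sym no.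
have [_] := edges_in_bound A; have [_] := edges_in_bound (~: A); rewrite e1 e2.
have a0 : 0 < #|A|%:R :> R by rewrite ltr0n card_gt0.
have b0 : 0 < #|~: A|%:R :> R by rewrite ltr0n card_gt0 -(inj_eq (@setC_inj _)) setCK setC0.
have ab : #|A|%:R + #|~: A|%:R = n%:R :> R by rewrite -natrD cardsC card_ord.
move: a0 b0 ab; set a := #|A|%:R; set b := #|~: A|%:R => a0 b0 ab hb ha.
have {}ha : d%:R * n%:R <= d%:R * a + lam * n%:R by rewrite -(ler_pM2r a0); lra.
have {}hb : d%:R * n%:R <= d%:R * b + lam * n%:R by rewrite -(ler_pM2r b0); lra.
have h : 2 * lam * n%:R < d%:R * n%:R by rewrite ltr_pM2r ?ndl_n_gt0 ?ndl_gap.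
have : d%:R * (a + b) = d%:R * n%:R by rewrite ab.
by move: ha hb h; lra.
Qed.

End Expansion.

(** * Growth rates *)

(** The weights q^(-|U|) sum to (1 + 1/q)^|V| over all [U], and each counted set has weight at least
    q^(-u). *)
Lemma card_small_sets (R : realFieldType) (V : finType) (q u : nat) : (0 < q)%N ->
  #|[set U : {set V} | #|U| <= u]%N|%:R <= (1 + q%:R^-1) ^+ #|V| * q%:R ^+ u :> R.
Proof.
move=> q0; have qR : 0 < q%:R :> R by rewrite ltr0n.
have -> : (1 + q%:R^-1) ^+ #|V| = \sum_(U : {set V}) q%:R^-1 ^+ #|U| :> R.
  rewrite addrC -prodr_const (bigA_distr _ _ _).
  apply: eq_bigr => U _; rewrite -big_mkcond /= prodr_const //.
rewrite -sum1_card natr_sum big_mkcond mulr_suml; apply: ler_sum => U _ /=.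
have h0 : 0 <= q%:R^-1 ^+ #|U| * q%:R ^+ u :> R by rewrite mulr_ge0 ?exprn_ge0 ?invr_ge0 ?ltW.
rewrite inE; case: ifP => // cU; rewrite exprVn mulrC.
by rewrite ler_pdivlMr ?exprn_gt0 // mul1r ler_weXn2l // ler1n.
Qed.

Lemma bernoulli (R : realFieldType) (x : R) (n : nat) : -1 <= x ->
  1 + n%:R * x <= (1 + x) ^+ n.
Proof.
move=> x1; elim: n => [|n IH]; first by rewrite mul0r addr0 expr0.
rewrite exprS -natr1.
have h : (1 + x) * (1 + n%:R * x) <= (1 + x) * (1 + x) ^+ n by apply: ler_wpM2l => //; lra.
apply: le_trans h; rewrite mulrDl mulrDr !mul1r mulrDl mul1r.
have : 0 <= n%:R * (x * x) by rewrite mulr_ge0 // -expr2 sqr_ge0.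
by lra.
Qed.

(** Supplies the unit in which all exponential losses are measured: [p] factors [1 + x] fit between
    [a] and [alpha]. *)
Lemma exists_root_ratio (R : realFieldType) (a alpha : R) (p : nat) : 0 < a -> a < alpha ->
  (0 < p)%N -> exists2 x, 0 < x & a * (1 + x) ^+ p <= alpha.
Proof.
move=> a0 aa p0; have al0 := lt_trans a0 aa.
have pR : 1 <= p%:R :> R by rewrite ler1n.
have r1 : a / alpha < 1 by rewrite ltr_pdivrMr // mul1r.
have r0 : 0 < a / alpha by rewrite divr_gt0.
pose x := (1 - a / alpha) / p%:R.
have x0 : 0 < x by rewrite divr_gt0 ?subr_gt0 // (lt_le_trans ltr01).
have x1 : x <= 1.
  rewrite ler_pdivrMr ?mul1r; last by rewrite (lt_le_trans ltr01).
  by apply: le_trans pR; lra.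
exists x => //.
(* (1 + x)^p (1 - p x) <= ((1 + x)(1 - x))^p <= 1, and 1 - p x = a / alpha *)
have h1 : a / alpha <= (1 - x) ^+ p.
  have := @bernoulli R (- x) p; rewrite mulrN => /(_ _).
  have -> : p%:R * x = 1 - a / alpha.
    by rewrite /x mulrC divfK // lt0r_neq0 // (lt_le_trans ltr01).
  by rewrite opprB addrC subrK; apply; lra.
have h2 : (1 + x) ^+ p * (1 - x) ^+ p <= 1.
  rewrite -exprMn exprn_ile1 //; last by have := sqr_ge0 x; rewrite expr2; lra.
  by rewrite mulr_ge0; lra.
have : (1 + x) ^+ p * (a / alpha) <= 1.
  by apply: le_trans h2; rewrite ler_wpM2l // exprn_ge0; lra.
by rewrite mulrA ler_pdivrMr // mul1r mulrC.
Qed.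

(** The ratio in the limit eventually exceeds 1/2, and the power 5/2 is rounded up to 3. *)
Lemma otter_lower (R : realType) (alpha : R) : otter_constant alpha ->
  exists2 C : R, 0 < C & exists N : nat, forall k, (N <= k)%N ->
    C * alpha ^+ k <= k%:R ^+ 3 * (num_unlabelled_trees k)%:R.
Proof.
move=> [al0 [C [C0 cv]]]; exists (C / 2); first by lra.
have h12 : 1 / 2 < 1 :> R by lra.
have [N _ NP] := cvgr_gt _ cv _ h12.
exists N.+1 => k Nk; have /NP /= : (N <= k)%N by rewrite ltnW.
have k0 : (0 < k)%N by apply: leq_ltn_trans Nk.
have k1 : 1 <= k%:R :> R by rewrite ler1n.
have kR : 0 < k%:R :> R by rewrite ltr0n.
have s0 : 0 < Num.sqrt k%:R :> R by rewrite sqrtr_gt0.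
set w := k%:R ^+ 2 * _; have w0 : 0 < w by rewrite mulr_gt0 ?exprn_gt0.
rewrite ltr_pdivlMr; last by apply: mulr_gt0; [apply: divr_gt0|apply: exprn_gt0].
set t := (num_unlabelled_trees k)%:R => lt_t.
have : 1 / 2 * (C * w^-1 * alpha ^+ k) * w < t * w by rewrite ltr_pM2r.
have -> : 1 / 2 * (C * w^-1 * alpha ^+ k) * w = C / 2 * alpha ^+ k.
  by field; rewrite lt0r_neq0.
move=> /ltW h; apply: le_trans h _; rewrite mulrC ler_wpM2r // /w [_ ^+ 3]exprSr ler_wpM2l ?exprn_ge0 //.
have : Num.sqrt k%:R <= Num.sqrt (k%:R ^+ 2) :> R by rewrite ler_wsqrtr // expr2 ler_peMl.
by rewrite sqrtr_sqr normr_nat.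
Qed.

(** By Bernoulli, four factors (1 + x)^k exceed (k x)^4, which beats the polynomial k^3 / C once k C
    x^4 >= 1. *)
Lemma trees_ge_pow (R : realType) (alpha b x : R) : otter_constant alpha ->
  0 < x -> 0 < b -> b * (1 + x) ^+ 4 <= alpha ->
  exists N : nat, forall k, (N <= k)%N -> b ^+ k <= (num_unlabelled_trees k)%:R.
Proof.
move=> ott x0 b0 balpha; have [C C0 [N NP]] := otter_lower ott.
have x4 : 0 < C * x ^+ 4 by rewrite mulr_gt0 ?exprn_gt0.
pose N2 := Num.Def.archi_bound (C * x ^+ 4)^-1.
have N2P : 1 < N2%:R * (C * x ^+ 4).
  by rewrite -ltr_pdivrMr // mul1r; apply: archi_boundP; rewrite invr_ge0 ltW.
exists (N + N2.+1)%N => k Nk; have {}NP := NP k (leq_trans (leq_addr _ _) Nk).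
have kR : 0 < k%:R :> R by rewrite ltr0n; lia.
have kN2 : 1 <= k%:R * (C * x ^+ 4).
  apply: le_trans (ltW N2P) _; rewrite (ler_wpM2r (ltW x4)) // ler_nat; lia.
have k3 : 0 < k%:R ^+ 3 :> R by rewrite exprn_gt0.
rewrite -(ler_pM2l k3); apply: le_trans NP.
have x1 : 0 <= 1 + x by lra.
have bx0 : 0 <= b * (1 + x) ^+ 4 by rewrite mulr_ge0 ?exprn_ge0 // ltW.
have h1 : (b * (1 + x) ^+ 4) ^+ k <= alpha ^+ k.
  by rewrite lerXn2r // nnegrE (le_trans bx0).
have h2 : k%:R * x <= (1 + x) ^+ k.
  have xm1 : -1 <= x by lra.
  by have := bernoulli k xm1; lra.
have h3 : (k%:R * x) ^+ 4 <= ((1 + x) ^+ 4) ^+ k.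
  by rewrite exprAC lerXn2r // nnegrE ?exprn_ge0 // mulr_ge0 // ltW.
have h4 : C * (b ^+ k * (k%:R * x) ^+ 4) <= C * alpha ^+ k.
  rewrite (ler_wpM2l (ltW C0)) // (le_trans _ h1) // [leRHS]exprMn ler_wpM2l // exprn_ge0 //.
  exact: ltW.
apply: le_trans h4.
have -> : C * (b ^+ k * (k%:R * x) ^+ 4) = k%:R ^+ 3 * b ^+ k * (k%:R * (C * x ^+ 4)) by ring.
by rewrite ler_peMr // mulr_ge0 ?exprn_ge0 ?ltW.
Qed.

(** * Choice of parameters and assembly of the bound *)

Lemma ndl_count_strings (R : realType) (n d k m M : nat) (lam : R) (e : rel 'I_n) :
  ndl_graph d lam e -> (0 < m)%N ->
  2 * (lam + k%:R) * n%:R < d%:R * m%:R ->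
  (k.+1 * M.+1 + k.+1 * m + 2 * m <= n)%N ->
  (num_unlabelled_trees k.+1 ^ M.+1 <=
   num_unlabelled_spanning_trees e *
   (#|[set U : {set 'I_n} | #|U| <= n - M.+1 * k.+1]| *
   (#|[set U : {set 'I_n} | #|U| <= M.+1]| * n)))%N.
Proof.
move=> ndl m0 gap room.
have mn : (m <= n)%N by move: room; clear; lia.
have n0 : (0 < n)%N by apply: leq_trans mn.
have := @count_strings 'I_n k M e; rewrite card_ord; apply => tau trt.
have [|phi str] := @string_search _ _ e m (ndl_sym ndl) m0 (ndl_joined ndl mn gap)
  (ndl_has_dense ndl mn gap) M.+1 tau trt _ (Ordinal n0); first by rewrite card_ord.
exists phi; apply: string_spanning (ndl_sym ndl) trt (ndl_cut ndl mn gap) str.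
Qed.

Lemma ndl_spanning_tree (R : realType) (n d k m : nat) (lam : R) (e : rel 'I_n) :
  ndl_graph d lam e -> (0 < m <= n)%N ->
  2 * (lam + k%:R) * n%:R < d%:R * m%:R ->
  (0 < num_unlabelled_spanning_trees e)%N.
Proof.
move=> ndl /andP[m0 mn] gap; have n0 : (0 < n)%N by apply: leq_trans mn.
have [||E [g _ sEG]] := @grown_extend _ (Ordinal n0) (edges_of e) _ _ _ (grown_start _).
- move=> A rA nA; have [|x [y [xA yA exy]]] := ndl_cut ndl mn gap _ nA.
    by apply/set0Pn; exists (Ordinal n0).
  by exists x, y; split=> //; apply/imset2P; exists x y; rewrite ?inE.
- exact: sub0set.
apply/card_gt0P; exists (iso_class (is_spanning_tree e) E).
apply/imsetP; exists E => //; rewrite inE; apply/asboolP; split=> //.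
exact: grown_tree g.
Qed.

(** As many rows of size [K] are taken as [room] allows. About (K + 2) m + K vertices stay
    uncovered, and L times this is at most n/4; [4 * L <= K] keeps L times the number of rows at
    most n/4 too. *)
Lemma string_parameters (L K n : nat) :
  (0 < L)%N -> (4 * L <= K)%N -> (16 * L * (K + 2) <= n)%N ->
  let m := (n %/ (8 * L * (K + 2))).+1 in
  exists M, [/\ (K * M.+1 + K * m + 2 * m <= n)%N, (L * (n - M.+1 * K + M.+1) <= n)%N,
    (n < m * (8 * L * (K + 2)))%N & (m <= n)%N].
Proof.
move=> L0 LK nL m.
have B0 : (0 < 8 * L * (K + 2))%N by rewrite !muln_gt0 L0 addn_gt0 orbT.
have mB : (n < m * (8 * L * (K + 2)))%N by rewrite ltn_ceil.
have mB' : (8 * (L * (K + 2) * m.-1) <= n)%N.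
  by rewrite !mulnA mulnC mulnA /=; have := leq_divM n (8 * L * (K + 2)); rewrite !mulnA.
have Qm : ((K + 2) * m = (K + 2) * m.-1 + (K + 2))%N by exact: mulnSr.
have LQ : (K + 2 <= L * (K + 2))%N by rewrite leq_pmull.
have LQm : ((K + 2) * m.-1 <= L * (K + 2) * m.-1)%N by rewrite -mulnA leq_pmull.
have h8 : (8 * ((K + 2) * m.-1) <= n)%N by move: mB' LQm; clear; lia.
have nLQ : (16 * (L * (K + 2)) <= n)%N by rewrite mulnA.
have room : ((K + 2) * m + K <= n)%N.
  by move: h8 Qm nLQ LQ; clear; lia.
have K0 : (0 < K)%N by lia.
pose r := (n - (K + 2) * m)%N.
have M0 : (0 < r %/ K)%N by rewrite divn_gt0 // /r; lia.
exists (r %/ K).-1; rewrite prednK //; set M := (r %/ K)%N.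
have KM : (M * K <= r)%N by exact: leq_divM.
have KM' : (r < M * K + K)%N by rewrite -mulSnr ltn_ceil.
have rE : (r + (K + 2) * m = n)%N by rewrite subnK // (leq_trans (leq_addr K _)).
split=> //.
- by move: KM rE; rewrite [(K * M)%N]mulnC mulnDl; clear; lia.
- have h1 : (n - M * K <= (K + 2) * m + K)%N by lia.
  have h2 : (L * (n - M * K) <= L * ((K + 2) * m + K))%N by rewrite leq_mul2l h1 orbT.
  have h3 : (4 * (L * M) <= n)%N.
    have : (4 * L * M <= K * M)%N by rewrite leq_mul2r LK orbT.
    by rewrite [(K * M)%N]mulnC; move: KM rE; clear; lia.
  have h4 : (L * ((K + 2) * m + K) <= L * (K + 2) * m.-1 + 2 * (L * (K + 2)))%N.
    by rewrite Qm !mulnDr !mulnA; lia.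
  by rewrite mulnDr; move: h2 h3 h4 mB' nLQ; clear; lia.
- by apply: leq_trans (leq_trans _ (leq_addr _ _)) room; rewrite leq_pmull // addn_gt0 orbT.
Qed.

(** The five factors (1 + x)^n absorb the losses: two for the powers of 1 + 1/q, two for the factor
    n, and one for q^(u + M) together with b^u, the missing contribution of the uncovered
    vertices. *)
Lemma pow_growth_bound (R : realFieldType) (a x cls t : R) (q n u M K : nat) (L : nat) :
  0 < x -> 1 <= a -> (0 < q)%N -> 1 <= q%:R * x -> 1 <= n%:R * x ^+ 2 ->
  q%:R * (a * (1 + x) ^+ 5) <= (1 + x) ^+ L ->
  (u + M * K = n)%N -> (L * (u + M) <= n)%N ->
  (a * (1 + x) ^+ 5) ^+ K <= t -> 0 <= cls ->
  t ^+ M <= cls * (((1 + q%:R^-1) ^+ n * q%:R ^+ u) * (((1 + q%:R^-1) ^+ n * q%:R ^+ M) * n%:R)) ->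
  a ^+ n <= cls.
Proof.
move=> x0 a1 q0 qx nx qL unE Ln bt cls0 tM.
set y := 1 + x in qL bt *; set b := a * y ^+ 5 in qL bt *.
have y1 : 1 <= y by rewrite /y; lra.
have y0 : 0 < y by lra.
have b1 : 1 <= b by rewrite mulr_ege1 // exprn_ege1.
have qR : 1 <= q%:R :> R by rewrite ler1n.
have q0R : 0 < q%:R :> R by lra.
have qi0 : 0 <= q%:R^-1 :> R by rewrite invr_ge0 ltW.
have qi : q%:R^-1 <= x by rewrite -[_^-1]mul1r ler_pdivrMr // mulrC.
have hq : (1 + q%:R^-1) ^+ n <= y ^+ n.
  by apply: lerXn2r; rewrite ?nnegrE /y; lra.
have hn : n%:R <= (y ^+ n) ^+ 2.
  have h1 : n%:R * x <= y ^+ n.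
    have xm1 : -1 <= x by lra.
    by have := bernoulli n xm1; rewrite /y; lra.
  apply: (@le_trans _ _ ((n%:R * x) ^+ 2)).
    by rewrite exprMn expr2 -mulrA ler_peMr.
  by rewrite lerXn2r // nnegrE ?exprn_ge0 ?mulr_ge0 // ltW.
(* Here (q b)^(u + M) <= y^(L (u + M)) and L (u + M) <= n. *)
have hL : q%:R ^+ u * q%:R ^+ M * b ^+ u <= y ^+ n.
  rewrite -exprD; apply: (@le_trans _ _ ((q%:R * b) ^+ (u + M))).
    by rewrite [leRHS]exprMn ler_wpM2l ?exprn_ge0 // ler_weXn2l // leq_addr.
  apply: (@le_trans _ _ ((y ^+ L) ^+ (u + M))).
    rewrite lerXn2r // nnegrE ?exprn_ge0 ?mulr_ge0 // ?ltW //; lra.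
  by rewrite -exprM ler_weXn2l.
have bn : b ^+ n = a ^+ n * (y ^+ n) ^+ 5 by rewrite /b exprMn -!exprM mulnC.
have b0 : 0 <= b ^+ u by rewrite exprn_ge0; lra.
have upper : b ^+ n <= cls * (y ^+ n) ^+ 5.
  rewrite -{1}unE exprD mulnC exprM.
  apply: (@le_trans _ _ (b ^+ u * t ^+ M)).
    rewrite ler_wpM2l // lerXn2r // nnegrE ?exprn_ge0 //; last by rewrite (le_trans _ bt) ?exprn_ge0; lra.
    by lra.
  apply: le_trans (ler_wpM2l b0 tM) _.
  set Z := (1 + q%:R^-1) ^+ n in hq *; set Y := y ^+ n in hq hn hL *.
  have Z0 : 0 <= Z by rewrite exprn_ge0 // addr_ge0 // invr_ge0.
  have Y0 : 0 <= Y by rewrite exprn_ge0 // ltW.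
  have -> : b ^+ u * (cls * (Z * q%:R ^+ u * (Z * q%:R ^+ M * n%:R))) =
     cls * (Z * Z * (n%:R * (q%:R ^+ u * q%:R ^+ M * b ^+ u))) by ring.
  have -> : Y ^+ 5 = Y * Y * (Y ^+ 2 * Y) by ring.
  rewrite ler_wpM2l // ler_pM //.
  - by rewrite mulr_ge0.
  - by rewrite !mulr_ge0 // exprn_ge0.
  - by rewrite ler_pM.
  - by rewrite ler_pM // !mulr_ge0 // exprn_ge0.
have Yp : 0 < (y ^+ n) ^+ 5 by rewrite !exprn_gt0.
by move: upper; rewrite bn ler_pM2r.
Qed.

Theorem theorem1p3 (R : realType) (alpha : R) :
  otter_constant alpha ->
  forall eps : R, 0 < eps -> eps < alpha ->
  exists (d0 : nat) (C : R) (N : nat),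
    forall (n : nat), (N <= n)%N ->
    forall (e : rel 'I_n) (d : nat) (lam : R),
      ndl_graph d lam e -> (d0 <= d)%N -> C <= (d%:R : R) / lam ->
      (alpha - eps) ^+ n <= (num_unlabelled_spanning_trees e)%:R.
Proof.
move=> ott eps eps0 epsal; set a := alpha - eps.
have a0 : 0 < a by rewrite subr_gt0.
have aal : a < alpha by rewrite /a; lra.
(* Nine factors: four spent in [trees_ge_pow] and five in [pow_growth_bound]. *)
have [x x0 xal] := exists_root_ratio (p := 9) a0 aal isT.
have b0 : 0 < a * (1 + x) ^+ 5 by rewrite mulr_gt0 // exprn_gt0; lra.
have [|N1 N1P] := trees_ge_pow ott x0 b0; first by rewrite -mulrA -exprD.
have [q q0 qx] : exists2 q : nat, (0 < q)%N & 1 <= q%:R * x.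
  exists (Num.Def.archi_bound x^-1).+1 => //.
  rewrite -ler_pdivrMr // mul1r -natr1 (le_trans (ltW (archi_boundP _))) ?lerDl //.
  by rewrite invr_ge0 ltW.
have [L L0 qL] : exists2 L : nat, (0 < L)%N &
    q%:R * (a * (1 + x) ^+ 5) <= (1 + x) ^+ L.
  exists (Num.Def.archi_bound (q%:R * (a * (1 + x) ^+ 5) / x)).+1 => //.
  have xm1 : -1 <= x by lra.
  apply: le_trans (bernoulli _ xm1).
  rewrite -[leLHS]add0r lerD // -ler_pdivrMr // -natr1.
  apply: le_trans (ltW (archi_boundP _)) _; last by rewrite lerDl.
  by apply: divr_ge0; [apply: mulr_ge0 => //; exact: ltW b0|exact: ltW].
have [N2 N2P] : exists N2 : nat, 1 <= N2%:R * x ^+ 2.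
  exists (Num.Def.archi_bound (x ^+ 2)^-1).
  by rewrite -ler_pdivrMr ?exprn_gt0 // mul1r ltW // archi_boundP // invr_ge0 sqr_ge0.
(* The tree size [k.+1] exceeds both [N1] and [4 * L]; [B] is the divisor defining [m], so that
   [n < m * B]. *)
pose k := (N1 + 4 * L)%N; pose B := (8 * L * (k.+1 + 2))%N.
(* The bounds 4 k B <= d and 4 B lam <= d give 2 (lam + k) B <= d, whence the gap. [2 * B] is the
   size required by [string_parameters], and [N2] gives n x^2 >= 1. *)
exists (4 * k * B).+1, (4 * B)%:R, (2 * B + N2)%N => n nN e d lam ndl dd0 dlam.
have B0 : (0 < B)%N by rewrite !muln_gt0 L0 addn_gt0 orbT.
have lam0 := ndl_lam_ge0 ndl.
have d0 : 0 < d%:R :> R by rewrite ltr0n; apply: leq_trans dd0.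
have BR : 0 < B%:R :> R by rewrite ltr0n.
have lamB : 4 * B%:R * lam <= d%:R.
  (* Clearing the denominator in [dlam] needs [lam > 0]; at [lam = 0] the bound is immediate. *)
  have [lamp|] := ltP 0 lam; last first.
    by move=> lamn; rewrite (_ : lam = 0) ?mulr0 ?ltW //; lra.
  by move: dlam; rewrite ler_pdivlMr // natrM.
have kB : 4 * k%:R * B%:R <= d%:R :> R by rewrite -!natrM ler_nat ltnW.
have [|||M [room LuM nm mn]] := @string_parameters L k.+1 n.
- by [].
- by rewrite leqW // leq_addl.
- by apply: leq_trans nN; apply: leq_trans (leq_addr _ _); rewrite /B !mulnA.
set m := (_ %/ _).+1 in room nm mn; rewrite -/B in nm.
have gap : 2 * (lam + k%:R) * n%:R < d%:R * m%:R.
  rewrite -(ltr_pM2r BR).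
  have h1 : d%:R * n%:R < d%:R * (m%:R * B%:R) :> R by rewrite ltr_pM2l // -natrM ltr_nat.
  have h2 : 2 * (lam + k%:R) * B%:R * n%:R <= d%:R * n%:R by rewrite ler_wpM2r //; move: kB lamB; lra.
  by move: h1 h2; lra.
(* For a base below 1 a single spanning tree suffices; the counting bound is applied for
   [1 <= a]. *)
have [a1|a1] := ltP a 1.
  apply: (@le_trans _ _ 1); first by rewrite exprn_ile1 // ltW.
  by rewrite ler1n; apply: (ndl_spanning_tree ndl _ gap); rewrite mn.
have := ndl_count_strings ndl (ltn0Sn _) gap room; rewrite -(ler_nat R) !natrM natrX => cnt.
apply: (@pow_growth_bound R a x _ (num_unlabelled_trees k.+1)%:R q n
  (n - M.+1 * k.+1) M.+1 k.+1 L) => //.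
- apply: le_trans N2P _; rewrite ler_wpM2r ?sqr_ge0 // ler_nat.
  exact: leq_trans (leq_addl _ _) nN.
- by apply: subnK; apply: leq_trans room; rewrite mulnC -addnA leq_addr.
- by apply: N1P; rewrite leqW // leq_addr.
apply: le_trans cnt _; rewrite ler_wpM2l // ler_pM // ?mulr_ge0 //.
  by have := card_small_sets R 'I_n (n - M.+1 * k.+1) q0; rewrite card_ord.
rewrite ler_wpM2r //.
by have := card_small_sets R 'I_n M.+1 q0; rewrite card_ord.
Qed.
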